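(* Let $R$ be a semiperfect ring and let $I$ be an idempotent two-sided ideal of $R$. Put $\mathcal{C}_I=\{M\in R\text{-}\mathrm{Mod}: IM=M\}$ and $\mathcal{T}_I=\{M\in R\text{-}\mathrm{Mod}: IM=0\}$. Then the following statements are equivalent. (a) $R/I$ is a silting module. (b) $I$ is the trace of a projective module. (c) There is a set $\{M_i\}_{i\in X}$ of finitely generated projective modules in $\mathcal{C}_I$ such that $\mathrm{Gen}(\bigoplus_{i\in X}M_i)=\mathcal{C}_I$. (d) There is a set $\{M_i\}_{i\in X}$ of finitely generated modules in $\mathcal{C}_I$ such that $\mathrm{Gen}(\bigoplus_{i\in X}M_i)=\mathcal{C}_I$. (e) $(\mathcal{C}_I,\mathcal{T}_I)$ is a tCG torsion pair.
   Context: Rings are associative with unit; modules are left $R$-modules; idempotent means $I^2=I$. The trace of a module $P$ is $\mathrm{Tr}(P)=\sum_{f\in \mathrm{Hom}_R(P,R)}\mathrm{Im}(f)$; projective modules in (b) are not assumed finitely generated. For a morphism $\sigma$ of modules put $\mathcal{D}_\sigma=\{X\in R\text{-}\mathrm{Mod} : \mathrm{Hom}_R(\sigma,X)\text{ is surjective}\}$. $\mathrm{Gen}(S)$ is the class of modules $M$ admitting an epimorphism $S^{(\alpha)}\to M$ for some set $\alpha$. A module $S$ is silting if there is a morphism $\sigma:P_{-1}\to P_0$ between projective modules with $S\cong\mathrm{Coker}(\sigma)$ and $\mathcal{D}_\sigma=\mathrm{Gen}(S)$. A torsion pair $(\mathcal{X},\mathcal{Y})$ in $R\text{-}\mathrm{Mod}$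 is a pair of classes with $\mathcal{X}=\{M:\mathrm{Hom}_R(M,Y)=0\ \forall Y\in\mathcal{Y}\}$ and $\mathcal{Y}=\{M:\mathrm{Hom}_R(X,M)=0\ \forall X\in\mathcal{X}\}$; $(\mathcal{C}_I,\mathcal{T}_I)$ is a torsion pair. A torsion pair $(\mathcal{X},\mathcal{Y})$ is tCG if its associated Happel-Reiten-Smal\o{} t-structure in the derived category $D(R)$ is compactly generated. This t-structure is $(\mathcal{U},\mathcal{U}^{\perp}[1])$ with $\mathcal{U}=\{U\in D(R): H^k(U)=0\text{ for }k>0,\ H^0(U)\in\mathcal{X}\}$ and $\mathcal{U}^{\perp}=\{V\in D(R):H^k(V)=0\text{ for }k<0,\ H^0(V)\in\mathcal{Y}\}$. It is compactly generated if there is a set $\mathcal{S}$ of compact objects of $D(R)$ such that $\mathcal{U}^{\perp}=\{V\in D(R):\mathrm{Hom}_{D(R)}(S[k],V)=0\text{ for all }S\in\mathcal{S},\ k\ge 0\}$. *)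

(* Defs.v *)
From HB Require Import structures.
From mathcomp Require Import all_boot all_order all_algebra.
From mathcomp Require Import boolp classical_sets functions cardinality.

Set Implicit Arguments.
Unset Strict Implicit.
Unset Printing Implicit Defensive.

Import GRing.Theory.
Local Open Scope ring_scope.
Local Open Scope quotient_scope.

Section Modules.
Variable R : pzRingType.
Implicit Types M N P S X Y : lmodType R.

Definition epi M N (f : {linear M -> N}) : Prop := forall y, exists x, f x = y.

Definition isomorphic M N : Prop := exists f : {linear M -> N}, bijective f.

Definition hom_zero M N : Prop := forall (f : {linear M -> N}) x, f x = 0.

Definition module_zero M : Prop := forall x : M, x = 0.

Definition projective P : Prop :=
  forall M N (g : {linear M -> N}) (f : {linear P -> N}),
    epi g -> exists h : {linear P -> M}, forall x, f x = g (h x).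

Definition finitely_generated M : Prop :=
  exists (n : nat) (g : 'I_n -> M),
    forall x, exists a : 'I_n -> R, x = \sum_(i < n) a i *: g i.

Definition superfluous M (K : set M) : Prop :=
  forall L : submodClosed M,
    (forall x, exists k l, [/\ K k, l \in L & x = k + l]) ->
    forall x, x \in L.

Definition projective_cover P M (p : {linear P -> M}) : Prop :=
  [/\ projective P, epi p & superfluous [set x | p x = 0]%classic].

End Modules.

(* Bass: every finitely generated module has a projective cover. *)
Definition semiperfect (R : pzRingType) : Prop :=
  forall M : lmodType R, finitely_generated M ->
    exists (P : lmodType R) (p : {linear P -> M}), projective_cover p.

Section Submodule.
Variables (R : pzRingType) (M : lmodType R) (N : submodClosed M).

Definition submod : Type := {x : M | x \in N}.
HB.instance Definition _ := SubChoice.on submod.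
HB.instance Definition _ := [SubChoice_isSubLmodule of submod by <:].

End Submodule.

Section QuotientModule.
Variables (R : pzRingType) (M : lmodType R) (N : submodClosed M).

(* The same predicate, with the closure under opposites needed by {quot _}. *)
Definition zmod_of_submod : {pred M} := [pred x | x \in N].

Fact zmod_of_submod_closed : zmod_closed zmod_of_submod.
Proof.
split=> [|x y]; rewrite !inE; first exact: rpred0.
by move=> Nx Ny; rewrite -scaleN1r rpredD ?rpredZ.
Qed.
HB.instance Definition _ :=
  GRing.isZmodClosed.Build M zmod_of_submod zmod_of_submod_closed.

Definition quotmod : Type := Quotient.quot zmod_of_submod.
HB.instance Definition _ := GRing.Zmodule.on quotmod.
HB.instance Definition _ := EqQuotient.on quotmod.

Lemma quotmodP (x y : M) :
  (\pi_quotmod x = \pi_quotmod y) <-> (x - y \in N).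
Proof.
split=> [/eqP|Nxy]; first by rewrite -Quotient.idealrBE.
by apply/eqP; rewrite -Quotient.idealrBE.
Qed.

Lemma quotmodD (x y : M) :
  \pi_quotmod (x + y) = \pi_quotmod x + \pi_quotmod y.
Proof. exact: Quotient.pi_add. Qed.

Definition quotmod_scale (a : R) (x : quotmod) : quotmod :=
  \pi_quotmod (a *: repr x).

Lemma quotmodZ a (x : M) : \pi_quotmod (a *: x) = quotmod_scale a (\pi x).
Proof.
have Nx : x - repr (\pi_quotmod x) \in N by apply: (proj1 (quotmodP _ _)); rewrite reprK.
by apply: (proj2 (quotmodP _ _)); rewrite -scalerBr; apply: rpredZ.
Qed.

Fact quotmod_scaleA a b x :
  quotmod_scale a (quotmod_scale b x) = quotmod_scale (a * b) x.
Proof.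
by rewrite -[x]reprK -(quotmodZ b) -(quotmodZ a) -(quotmodZ (a * b)) scalerA.
Qed.

Fact quotmod_scale1 : left_id 1 quotmod_scale.
Proof. by move=> x; rewrite -[x]reprK -quotmodZ scale1r. Qed.

Fact quotmod_scaleDr : right_distributive quotmod_scale +%R.
Proof.
move=> a x y; rewrite -[x]reprK -[y]reprK -quotmodD -!quotmodZ -quotmodD.
by rewrite scalerDr.
Qed.

Fact quotmod_scaleDl x : {morph quotmod_scale^~ x : a b / a + b}.
Proof.
by move=> a b; rewrite -[x]reprK -!quotmodZ -quotmodD scalerDl.
Qed.

HB.instance Definition _ := GRing.Zmodule_isLmodule.Build R quotmod
  quotmod_scaleA quotmod_scale1 quotmod_scaleDr quotmod_scaleDl.

End QuotientModule.

Section Cokernel.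
Variables (R : pzRingType) (M N : lmodType R) (f : {linear M -> N}).

Definition im_sub : {pred N} := [pred y | `[< exists x, f x = y >]].
Fact im_sub_closed : submod_closed im_sub.
Proof.
split=> [|a x y]; rewrite !inE; first by exists 0; rewrite linear0.
move=> [u <-] [v <-].
by exists (a *: u + v); rewrite linearP.
Qed.
HB.instance Definition _ := GRing.isSubmodClosed.Build R N im_sub
  (GRing.submod_closed_semi im_sub_closed).

Definition coker : lmodType R := quotmod im_sub.

End Cokernel.

Section DirectSum.
Variables (R : pzRingType) (J : choiceType) (M : J -> lmodType R).

Definition dprod : Type := forall j, M j.
HB.instance Definition _ := Choice.on dprod.

Fact dprod_addA : associative (fun f g : dprod => (fun j => f j + g j) : dprod).
Proof. by move=> f g h; apply: functional_extensionality_dep => j; rewrite addrA. Qed.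
Fact dprod_addC : commutative (fun f g : dprod => (fun j => f j + g j) : dprod).
Proof. by move=> f g; apply: functional_extensionality_dep => j; rewrite addrC. Qed.
Fact dprod_add0 :
  left_id ((fun j => 0) : dprod) (fun f g : dprod => (fun j => f j + g j) : dprod).
Proof. by move=> f; apply: functional_extensionality_dep => j; rewrite add0r. Qed.
Fact dprod_addN : left_inverse ((fun j => 0) : dprod)
  (fun f : dprod => (fun j => - f j) : dprod)
  (fun f g : dprod => (fun j => f j + g j) : dprod).
Proof. by move=> f; apply: functional_extensionality_dep => j; rewrite addNr. Qed.
HB.instance Definition _ :=
  GRing.isZmodule.Build dprod dprod_addA dprod_addC dprod_add0 dprod_addN.

Definition dprod_scale (a : R) (f : dprod) : dprod := fun j => a *: f j.
Fact dprod_scaleA a b f :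
  dprod_scale a (dprod_scale b f) = dprod_scale (a * b) f.
Proof. by apply: functional_extensionality_dep => j; rewrite /dprod_scale scalerA. Qed.
Fact dprod_scale1 : left_id 1 dprod_scale.
Proof. by move=> f; apply: functional_extensionality_dep => j; exact: scale1r. Qed.
Fact dprod_scaleDr : right_distributive dprod_scale +%R.
Proof. by move=> a f g; apply: functional_extensionality_dep => j; exact: scalerDr. Qed.
Fact dprod_scaleDl f : {morph dprod_scale^~ f : a b / a + b}.
Proof. by move=> a b; apply: functional_extensionality_dep => j; exact: scalerDl. Qed.
HB.instance Definition _ := GRing.Zmodule_isLmodule.Build R dprod
  dprod_scaleA dprod_scale1 dprod_scaleDr dprod_scaleDl.

Definition finsupp : {pred dprod} :=
  [pred f | `[< finite_set [set j | f j <> 0]%classic >]].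
Fact finsupp_closed : submod_closed finsupp.
Proof.
split=> [|a f g]; rewrite !inE.
  rewrite (_ : [set j | _]%classic = set0) //.
  by rewrite -subset0 => j /=; apply.
move=> Ff Fg.
apply: (@sub_finite_set _ _
  ([set j | f j <> 0] `|` [set j | g j <> 0])%classic); last first.
  by rewrite finite_setU.
move=> j /= nz; have [f0|] := pselect (f j = 0); last by left.
have [g0|] := pselect (g j = 0); last by right.
by case: nz; change (a *: f j + g j = 0); rewrite f0 g0 scaler0 addr0.
Qed.
HB.instance Definition _ := GRing.isSubmodClosed.Build R dprod finsupp
  (GRing.submod_closed_semi finsupp_closed).

Definition dsum : lmodType R := submod finsupp.

End DirectSum.
Arguments finsupp {R J} M.

Section Classes.
Variable R : pzRingType.
Implicit Types M P Q S X : lmodType R.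

(* Index sets of direct sums and families are choiceTypes: classically every
   type is one, and dsum forces them to be no larger than modules are, so that
   they range exactly over small sets.                                        *)
Definition Gen S M : Prop :=
  exists (alpha : choiceType) (f : {linear dsum (fun _ : alpha => S) -> M}),
    epi f.

Definition D_class P Q (s : {linear P -> Q}) X : Prop :=
  forall f : {linear P -> X}, exists g : {linear Q -> X}, forall x, f x = g (s x).

Definition silting S : Prop :=
  exists (P Q : lmodType R) (s : {linear P -> Q}),
    [/\ projective P, projective Q, isomorphic S (coker s)
      & forall X, D_class s X <-> Gen S X].

Definition two_sided (I : submodClosed R^o) : Prop :=
  forall x a : R, x \in I -> (x * a : R^o) \in I.

(* I N: the additive subgroup generated by the products a m, a in I, m in N. *)
Definition ideal_smul (I : submodClosed R^o) M (N : set M) : set M :=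
  [set x | exists (n : nat) (a : 'I_n -> R) (m : 'I_n -> M),
     [/\ forall i, (a i : R^o) \in I, forall i, N (m i)
       & x = \sum_(i < n) a i *: m i]]%classic.

Definition idempotent_ideal (I : submodClosed R^o) : Prop :=
  @ideal_smul I R^o [set` I]%classic = [set` I]%classic.

Definition trace P : set R^o :=
  [set r | exists (n : nat) (f : 'I_n -> {linear P -> R^o}) (x : 'I_n -> P),
     r = \sum_(i < n) f i (x i)]%classic.

Definition C_class (I : submodClosed R^o) M : Prop :=
  @ideal_smul I M setT = setT.

Definition T_class (I : submodClosed R^o) M : Prop :=
  @ideal_smul I M setT = [set 0]%classic.

Definition torsion_pair (X Y : lmodType R -> Prop) : Prop :=
  (forall M, X M <-> (forall N, Y N -> hom_zero M N)) /\
  (forall N, Y N <-> (forall M, X M -> hom_zero M N)).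

End Classes.

Section Complexes.
Variable R : pzRingType.

(* Cohomological indexing. The differential is given for all pairs of degrees
   and vanishes unless j = i + 1, so that no transport along equalities of
   degrees is needed.                                                         *)
Record complex := Complex {
  cobj :> int -> lmodType R;
  cdiff : forall i j, {linear cobj i -> cobj j};
  cdiff_shape : forall i j, j != i + 1 -> forall x, cdiff i j x = 0;
  cdiff_sq : forall i j k x, cdiff j k (cdiff i j x) = 0 }.

Record cmap (X Y : complex) := Cmap {
  cmap_fun :> forall n, {linear X n -> Y n};
  cmapP : forall i j x, cmap_fun j (cdiff X i j x) = cdiff Y i j (cmap_fun i x) }.

Program Definition cmap_id X : cmap X X := @Cmap X X (fun n => idfun) _.

Program Definition cmap_zero X Y : cmap X Y := @Cmap X Y (fun n => \0) _.
Next Obligation. by rewrite linear0. Qed.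

Program Definition cmap_comp X Y Z (g : cmap Y Z) (f : cmap X Y) : cmap X Z :=
  @Cmap X Z (fun n => g n \o f n) _.
Next Obligation. by rewrite !cmapP. Qed.

Definition homotopic X Y (f g : cmap X Y) : Prop :=
  exists h : forall i j, {linear X i -> Y j}, forall n x,
    f n x - g n x = cdiff Y (n - 1) n (h n (n - 1) x)
                  + h (n + 1) n (cdiff X n (n + 1) x).

Section Cohomology.
Variables (X : complex) (k : int).

Definition cocycle : {pred X k} := [pred x | cdiff X k (k + 1) x == 0].
Fact cocycle_closed : submod_closed cocycle.
Proof.
split=> [|a x y]; rewrite !inE ?linear0 // => /eqP dx /eqP dy.
by rewrite linearP dx dy scaler0 addr0.
Qed.
HB.instance Definition _ := GRing.isSubmodClosed.Build R (X k) cocycle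
  (GRing.submod_closed_semi cocycle_closed).

Definition coboundary : {pred submod cocycle} :=
  [pred z | `[< exists y, val z = cdiff X (k - 1) k y >]].
Fact coboundary_closed : submod_closed coboundary.
Proof.
split=> [|a x y]; rewrite !inE.
  by exists 0; rewrite !linear0.
move=> [u xu] [v yv].
by exists (a *: u + v); rewrite [RHS]linearP -xu -yv.
Qed.
HB.instance Definition _ := GRing.isSubmodClosed.Build R (submod cocycle)
  coboundary (GRing.submod_closed_semi coboundary_closed).

Definition cohomology : lmodType R := quotmod coboundary.

End Cohomology.
Arguments cocycle X k : clear implicits.

Section CohomologyMap.
Variables (X Y : complex) (f : cmap X Y) (k : int).

Fact cocycle_map_subproof (z : submod (cocycle X k)) :
  f k (val z) \in cocycle Y k.
Proof.
by case: z => z /= /eqP dz; rewrite inE -cmapP dz linear0.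
Qed.

Definition cocycle_map (z : submod (cocycle X k)) : submod (cocycle Y k) :=
  Sub (f k (val z)) (cocycle_map_subproof z).

Definition cohomology_map (x : cohomology X k) : cohomology Y k :=
  \pi_(cohomology Y k) (cocycle_map (repr x)).

End CohomologyMap.

Definition quasi_iso X Y (f : cmap X Y) : Prop :=
  forall k, bijective (@cohomology_map X Y f k).

Section Shift.
Variables (X : complex) (m : int).

Definition shift_diff i j (x : X (i + m)) : X (j + m) :=
  (-1) ^+ `|m|%N *: cdiff X (i + m) (j + m) x.
Fact shift_diff_linear i j : linear (@shift_diff i j).
Proof.
move=> a x y; rewrite /shift_diff linearP scalerDr !scalerA.
by rewrite -(commr_sign a).
Qed.
HB.instance Definition _ i j :=
  GRing.isLinear.Build R (X (i + m)) (X (j + m)) _ (@shift_diff i j)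
    (@shift_diff_linear i j).

Program Definition shift : complex :=
  @Complex (fun n => X (n + m)) (fun i j => @shift_diff i j) _ _.
Next Obligation.
rewrite /shift_diff cdiff_shape ?scaler0 // addrAC.
by apply: contra H => /eqP/addIr/eqP.
Qed.
Next Obligation.
by rewrite /shift_diff linearZ /= cdiff_sq !scaler0.
Qed.

End Shift.

Section DirectSumComplex.
Variables (J : choiceType) (X : J -> complex).

Definition csum_diff_fun i k (f : dsum (fun j => X j i)) :
    dprod (fun j => X j k) := fun j => cdiff (X j) i k (val f j).
Fact csum_diff_subproof i k (f : dsum (fun j => X j i)) :
  csum_diff_fun k f \in finsupp (fun j => X j k).
Proof.
rewrite /csum_diff_fun; case: f => f /=; rewrite !inE; apply: sub_finite_set => j /= nz f0.
by apply: nz; rewrite f0 linear0.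
Qed.

Definition csum_diff i k (f : dsum (fun j => X j i)) : dsum (fun j => X j k) :=
  (Sub (csum_diff_fun k f) (csum_diff_subproof k f)
    : submod (finsupp (fun j => X j k))).
Fact csum_diff_linear i k : linear (@csum_diff i k).
Proof.
move=> a f g; apply: val_inj; apply: functional_extensionality_dep => j /=.
exact: linearP.
Qed.
HB.instance Definition _ i k :=
  GRing.isLinear.Build R (dsum (fun j => X j i)) (dsum (fun j => X j k)) _
    (@csum_diff i k) (@csum_diff_linear i k).

Program Definition csum : complex :=
  @Complex (fun n => dsum (fun j => X j n)) (fun i k => @csum_diff i k) _ _.
Next Obligation.
apply: val_inj; apply: functional_extensionality_dep => k /=.
exact: cdiff_shape.
Qed.
Next Obligation.
apply: val_inj; apply: functional_extensionality_dep => l /=.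
exact: cdiff_sq.
Qed.

End DirectSumComplex.

(* Morphisms X -> Y of D(R), the localization of the homotopy category at
   quasi-isomorphisms: fractions num o den^-1 up to the relation roof_eq.     *)
Record roof (X Y : complex) := Roof {
  apex : complex;
  den : cmap apex X;
  den_qis : quasi_iso den;
  num : cmap apex Y }.

Definition roof_eq X Y (a b : roof X Y) : Prop :=
  exists (W : complex) (u : cmap W (apex a)) (v : cmap W (apex b)),
    [/\ quasi_iso (cmap_comp (den a) u),
        homotopic (cmap_comp (den a) u) (cmap_comp (den b) v)
      & homotopic (cmap_comp (num a) u) (cmap_comp (num b) v)].

Fact cmap_id_qis X : quasi_iso (cmap_id X).
Proof.
move=> k; exists id => x; rewrite -[RHS]reprK; congr (\pi_(cohomology X k) _);
  exact: val_inj.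
Qed.

Definition roof_zero X Y : roof X Y := Roof (@cmap_id_qis X) (cmap_zero X Y).

Definition derived_hom_zero X Y : Prop :=
  forall a : roof X Y, roof_eq a (roof_zero X Y).

(* psi is the image of the family phi (almost all of whose members are zero)
   under the canonical map (+)_j Hom(S, X_j) -> Hom(S, (+)_j X_j): over a common
   denominator s, phi_j = f_j s^-1 and psi = (sum_j iota_j f_j) s^-1; coproducts
   in D(R) are direct sums of complexes.                                      *)
Definition coprod_hom (S : complex) (J : choiceType) (X : J -> complex)
    (phi : forall j, roof S (X j)) (psi : roof S (csum X)) : Prop :=
  exists (W : complex) (s : cmap W S) (qs : quasi_iso s)
    (f : forall j, cmap W (X j)) (g : cmap W (csum X)),
    [/\ finite_set [set j | ~ (forall n w, f j n w = 0)]%classic,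
        forall n w j, val (g n w) j = f j n w,
        forall j, roof_eq (phi j) (Roof qs (f j))
      & roof_eq psi (Roof qs g)].

(* Hom(S, -) commutes with coproducts: the map of coprod_hom is bijective. *)
Definition compact (S : complex) : Prop :=
  forall (J : choiceType) (X : J -> complex),
    (forall psi : roof S (csum X), exists phi, coprod_hom phi psi) /\
    (forall (phi phi' : forall j, roof S (X j)) (psi : roof S (csum X)),
       coprod_hom phi psi -> coprod_hom phi' psi ->
       forall j, roof_eq (phi j) (phi' j)).

(* A t-structure (U, U^perp[1]) is recorded by the pair of classes (U, U^perp). *)
Definition hrs_t_structure (X Y : lmodType R -> Prop) :
    (complex -> Prop) * (complex -> Prop) :=
  ((fun U => (forall k, 0 < k -> module_zero (cohomology U k)) /\
             X (cohomology U 0)),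
   (fun V => (forall k, k < 0 -> module_zero (cohomology V k)) /\
             Y (cohomology V 0))).

Definition compactly_generated (t : (complex -> Prop) * (complex -> Prop)) :
    Prop :=
  exists (J : choiceType) (S : J -> complex), (forall j, compact (S j)) /\
    forall V, t.2 V <->
      forall (j : J) (k : nat), derived_hom_zero (shift (S j) k%:Z) V.

Definition tCG (X Y : lmodType R -> Prop) : Prop :=
  torsion_pair X Y /\ compactly_generated (hrs_t_structure X Y).

End Complexes.

(* Main.v *)
(* Over a semiperfect ring all conditions are equivalent to I = ReR for an
   idempotent e in I.  The complement of the projective cover of R/I in R is Re
   with e in I and I(1-e) inside the Jacobson radical; by Nakayama, modules Y
   with eY = 0 receive no nonzero map from a finitely generated, or a
   projective, module P with P = IP.  Each condition provides such modules in
   sufficient number to detect IY = 0, so that Y = R/ReR yields I = ReR.  For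
   (e) they are the H^0(S), S a compact generator of the aisle: H^k(S) = 0 for
   k > 0, H^0(S) = I H^0(S), and H^0(S) is finitely generated because S is
   compact.  Conversely, when I = ReR, the compact objects Re and R[1] generate
   the t-structure. *)

Require Import Defs.
From HB Require Import structures.
From mathcomp Require Import all_boot all_order all_algebra.
From mathcomp Require Import zify.
From mathcomp Require Import boolp classical_sets functions cardinality fsbigop.

Set Implicit Arguments.
Unset Strict Implicit.
Unset Printing Implicit Defensive.

Import GRing.Theory.
Local Open Scope ring_scope.
Local Open Scope quotient_scope.

(** * Direct sums, submodules and quotients *)

(** On a module Y killed by e an element a of I acts as a(1-e), which lies in the radical; hence a
    finite system y_i = sum_j b_ij y_j with b_ij in I has only the zero solution in Y. For finitely
    generated P = IP the images of generators satisfy such a system. A projective P may need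
    infinitely many generators; there the transposed system is used, satisfied by the finitely many
    dual basis coordinates of a single element. In (a) and (e) the modules to which this applies are
    not given and must be extracted: from a silting presentation by splitting off its trivial part,
    and from a generator S by mapping it to a truncation of S lying in U^perp, where the projection
    has to vanish. Morphisms of D(R) are fractions, and each argument replaces them by chain maps in
    its own way: out of projective stalks by splitting the denominator, into a stalk by truncating
    the apex, out of a compact object by refining the denominator and subtracting homotopies until
    supports become finite. *)

Section AdditiveSpan.
Variable M : zmodType.
Implicit Types (G : set M) (x y : M).

(** Common form of IM and of the ideal ReR, both spanned additively by products; [addspan_ind]
    reduces claims about them to a single product. *)
Definition addspan G x : Prop :=
  exists (n : nat) (g : 'I_n -> M), (forall i, G (g i)) /\ x = \sum_(i < n) g i.

Lemma addspan_mem G x : G x -> addspan G x.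
Proof. by move=> Gx; exists 1%N, (fun=> x); split=> //; rewrite big_ord1. Qed.

Lemma addspan0 G : addspan G 0.
Proof. by exists 0%N, (fun=> 0); split=> [[]//|]; rewrite big_ord0. Qed.

Lemma addspanD G x y : addspan G x -> addspan G y -> addspan G (x + y).
Proof.
move=> [m [g [Gg ->]]] [n [h [Gh ->]]].
exists (m + n)%N, (fun i => match fintype.split i with inl j => g j | inr j => h j end).
split=> [i|]; first by case: (fintype.split i).
rewrite big_split_ord /=; congr (_ + _); apply: eq_bigr => i _.
  by rewrite (unsplitK (inl i)).
by rewrite (unsplitK (inr i)).
Qed.

Lemma addspan_sum G (J : Type) (r : seq J) (F : J -> M) :
  (forall j, addspan G (F j)) -> addspan G (\sum_(j <- r) F j).
Proof.
by move=> GF; elim/big_ind: _ => //; [exact: addspan0 | exact: addspanD].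
Qed.

Lemma addspan_ind G (P : M -> Prop) :
  P 0 -> (forall x y, P x -> P y -> P (x + y)) -> (forall x, G x -> P x) ->
  forall x, addspan G x -> P x.
Proof.
by move=> P0 PD PG x [n [g [Gg ->]]]; elim/big_ind: _ => // i _; apply: PG.
Qed.

End AdditiveSpan.

Definition mklin (R : pzRingType) (M N : lmodType R) (f : M -> N)
  (fP : linear f) : {linear M -> N} := HB.pack f (GRing.isLinear.Build R M N _ f fP).
Arguments mklin : simpl never.

Lemma mklinE (R : pzRingType) (M N : lmodType R) (f : M -> N) (fP : linear f) x :
  mklin fP x = f x.
Proof. by []. Qed.

Section Modules.
Variable R : pzRingType.
Implicit Types M N P Q X Y : lmodType R.

Lemma mkrow_subproof M (x : M) : linear (fun r : R^o => (r : R) *: x).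
Proof. by move=> a u v; rewrite scalerDl scalerA. Qed.

Definition mkrow M (x : M) : {linear R^o -> M} := mklin (mkrow_subproof x).

Lemma mkrowE M (x : M) (r : R) : mkrow x r = r *: x.
Proof. by []. Qed.

Section MkSubmod.
Variables (M : lmodType R) (G : set M).
Hypotheses (G0 : G 0) (GD : forall x y, G x -> G y -> G (x + y))
  (GZ : forall a x, G x -> G (a *: x)).
Definition pred_of_set_sub : {pred M} := [pred x | `[< G x >]].
Fact mksub_closed : submod_closed pred_of_set_sub.
Proof.
split; rewrite ?inE // => a x y; rewrite !inE => Gx Gy.
by apply: GD => //; apply: GZ.
Qed.
HB.instance Definition _ := GRing.isSubmodClosed.Build R M pred_of_set_sub
  (GRing.submod_closed_semi mksub_closed).
Definition mksub : submodClosed M := pred_of_set_sub.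
Lemma mksubP x : (x \in mksub) <-> G x.
Proof. by rewrite inE. Qed.
End MkSubmod.

Section SubQuot.
Variables (M : lmodType R) (N : submodClosed M).

Lemma subinj_subproof : linear (fun x : submod N => val x).
Proof. by []. Qed.
Definition subinj : {linear submod N -> M} := mklin subinj_subproof.

Definition corestr_fun X (f : {linear X -> M}) (fN : forall x, f x \in N) (x : X) :
  submod N := Sub (f x) (fN x).
Lemma corestr_subproof X (f : {linear X -> M}) fN : linear (@corestr_fun X f fN).
Proof. by move=> a x y; apply: val_inj; rewrite /= linearP. Qed.
Definition corestr X (f : {linear X -> M}) fN : {linear X -> submod N} :=
  mklin (@corestr_subproof X f fN).

Lemma quotpi_subproof : linear (fun x : M => \pi_(quotmod N) x : quotmod N).
Proof. by move=> a x y; rewrite quotmodD quotmodZ. Qed.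
Definition quotpi : {linear M -> quotmod N} := mklin quotpi_subproof.

Lemma quotpi_epi : epi quotpi.
Proof. by move=> y; exists (repr y); rewrite /= reprK. Qed.

Lemma quotpi_eq0 x : (quotpi x = 0) <-> (x \in N).
Proof. by rewrite -(linear0 quotpi) quotmodP subr0. Qed.

Lemma quotpi_eq x y : (quotpi x = quotpi y) <-> (x - y \in N).
Proof. exact: quotmodP. Qed.

Definition quotlift_fun X (f : {linear M -> X}) (x : quotmod N) : X := f (repr x).
Section Lift.
Variables (X : lmodType R) (f : {linear M -> X}).
Hypothesis fN : forall x, x \in N -> f x = 0.
Lemma quotlift_fun_pi x : quotlift_fun f (quotpi x) = f x.
Proof.
apply/eqP; rewrite -subr_eq0 -linearB; apply/eqP/fN/quotpi_eq.
by rewrite /= reprK.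
Qed.
Lemma quotlift_subproof : linear (quotlift_fun f).
Proof.
move=> a x y; have [u <-] := quotpi_epi x; have [v <-] := quotpi_epi y.
by rewrite -linearP !quotlift_fun_pi linearP.
Qed.
Definition quotlift : {linear quotmod N -> X} := mklin quotlift_subproof.
Lemma quotliftE x : quotlift (quotpi x) = f x.
Proof. exact: quotlift_fun_pi. Qed.
End Lift.
End SubQuot.

Section DsumUniversal.
Variables (J : choiceType) (M : J -> lmodType R).

Lemma dsumP (x y : dsum M) : (forall j, val x j = val y j) -> x = y.
Proof. by move=> xy; apply: val_inj; apply: functional_extensionality_dep. Qed.

Lemma dsum_fin (x : dsum M) : finite_set [set j | val x j <> 0]%classic.
Proof. by case: x => x /=; rewrite inE. Qed.

Lemma mkdsum_subproof (f : forall j, M j) :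
  finite_set [set j | f j <> 0]%classic -> (f : dprod M) \in finsupp M.
Proof. by move=> ?; rewrite inE. Qed.
Definition mkdsum (f : forall j, M j) fP : dsum M := Sub (f : dprod M) (@mkdsum_subproof f fP).

Definition dsum_in_fun j (x : M j) : dprod M := dfwith (fun k => 0 : M k) x.

Lemma dsum_in_fin j (x : M j) : dsum_in_fun x \in finsupp M.
Proof.
rewrite inE; apply: (@sub_finite_set _ _ [set j]%classic); last exact: finite_set1.
move=> k /=; have [->//|kj] := eqVneq k j.
by rewrite /dsum_in_fun dfwith_out // eq_sym.
Qed.

Lemma dsum_in_subproof j :
  linear (fun x : M j => Sub (dsum_in_fun x) (dsum_in_fin x) : dsum M).
Proof.
move=> a x y; apply: dsumP => k /=.
have [<-|jk] := eqVneq j k.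
  transitivity (a *: x + y); first exact: dfwith_in.
  by congr (a *: _ + _); symmetry; apply: dfwith_in.
transitivity (0 : M k); first exact: dfwith_out.
transitivity (a *: (0 : M k) + 0); first by rewrite scaler0 addr0.
by congr (a *: _ + _); symmetry; apply: dfwith_out.
Qed.
Definition dsum_in j : {linear M j -> dsum M} := mklin (@dsum_in_subproof j).

Lemma dsum_inE j (x : M j) : val (dsum_in j x) j = x.
Proof. exact: dfwith_in. Qed.
Lemma dsum_in0 j k (x : M j) : j != k -> val (dsum_in j x) k = 0.
Proof. by move=> jk; apply: dfwith_out. Qed.

Lemma dsum_proj_subproof j : linear (fun x : dsum M => val x j).
Proof. by []. Qed.
Definition dsum_proj j : {linear dsum M -> M j} := mklin (@dsum_proj_subproof j).

Lemma dsum_decomp (r : seq J) (x : dsum M) :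
  uniq r -> (forall j, val x j <> 0 -> j \in r) ->
  x = \sum_(j <- r) dsum_in j (val x j).
Proof.
move=> ur xr; apply: dsumP => j.
have -> : val (\sum_(j <- r) dsum_in j (val x j)) j =
   \sum_(k <- r) val (dsum_in k (val x k)) j.
  by elim/big_rec2: _ => // i u v _ <-.
have [jr|jr] := boolP (j \in r).
  rewrite (bigD1_seq j) // big1 => [|k kj]; last exact: dsum_in0.
  by rewrite dsum_inE; exact: esym (addr0 _).
rewrite big_seq big1 => [|k kr].
  by apply: contrapT => nz; move/negP: jr; apply; apply: xr.
by apply: dsum_in0; apply: contraNneq jr => <-.
Qed.

Lemma dsum_supp (x : dsum M) : exists r : seq J,
  uniq r /\ (forall j, val x j <> 0 -> j \in r).
Proof.
have [r rE] := (finite_seqP _).1 (dsum_fin x).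
exists (undup r); split; first exact: undup_uniq.
by move=> j nz; have : [set j | val x j <> 0]%classic j by []; rewrite rE mem_undup.
Qed.

Lemma dsum_ind (P : dsum M -> Prop) :
  P 0 -> (forall x y, P x -> P y -> P (x + y)) -> (forall j x, P (dsum_in j x)) ->
  forall x, P x.
Proof.
move=> P0 PD Pin x; have [r [ur xr]] := dsum_supp x.
by rewrite (dsum_decomp ur xr); elim/big_ind: _.
Qed.

Section Lift.
Variables (X : lmodType R) (f : forall j, {linear M j -> X}).
(** A finitely supported sum over all of J, so that no choice of support enters; any list containing
    the support computes it. *)
Definition dsum_lift_fun (x : dsum M) : X := \sum_(j \in [set: J]) f j (val x j).
Lemma dsum_lift_funE (r : seq J) x : uniq r -> (forall j, val x j <> 0 -> j \in r) ->
  dsum_lift_fun x = \sum_(j <- r) f j (val x j).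
Proof.
move=> ur xr; rewrite (fsbig_seq _ _ ur) /dsum_lift_fun.
symmetry; apply: fsbig_widen => // j [_] /= jr.
have [->|/xr//] := pselect (val x j = 0); exact: linear0.
Qed.
Lemma dsum_lift_subproof : linear dsum_lift_fun.
Proof.
move=> a x y; have [r [_ xr]] := dsum_supp x; have [s [_ ys]] := dsum_supp y.
rewrite !(@dsum_lift_funE (undup (r ++ s))) ?undup_uniq //.
- by rewrite scaler_sumr -big_split; apply: eq_bigr => j _ /=; rewrite -linearP.
- by move=> j /ys; rewrite mem_undup mem_cat orbC => ->.
- by move=> j /xr; rewrite mem_undup mem_cat => ->.
move=> j; rewrite mem_undup mem_cat.
case: (boolP (j \in r)) => //= jr; case: (boolP (j \in s)) => //= js [].
change (a *: val x j + val y j = 0).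
have -> : val x j = 0 by apply: contrapT => /xr; exact/negP.
have -> : val y j = 0 by apply: contrapT => /ys; exact/negP.
by rewrite scaler0 addr0.
Qed.
Definition dsum_lift : {linear dsum M -> X} := mklin dsum_lift_subproof.
Lemma dsum_lift_in j x : dsum_lift (dsum_in j x) = f j x.
Proof.
rewrite /= (@dsum_lift_funE [:: j]) ?big_seq1 ?dsum_inE // => k.
rewrite inE; have [//|kj] := eqVneq k j; rewrite dsum_in0 //.
by rewrite eq_sym.
Qed.
End Lift.

Lemma dsum_eq_lin X (f g : {linear dsum M -> X}) :
  (forall j x, f (dsum_in j x) = g (dsum_in j x)) -> forall x, f x = g x.
Proof.
by move=> fg; apply: dsum_ind => [|x y|//]; rewrite ?linear0 // !linearD => -> ->.
Qed.
End DsumUniversal.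

Definition free (A : choiceType) : lmodType R := dsum (fun _ : A => R^o).

Section Free.
Variables (A : choiceType).
Definition fbase (a : A) : free A := dsum_in (fun _ : A => R^o) a 1.
Definition flift X (f : A -> X) : {linear free A -> X} :=
  @dsum_lift A (fun=> R^o) X (fun a => mkrow (f a)).
Lemma flift_base X (f : A -> X) a : flift f (fbase a) = f a.
Proof. by rewrite [LHS]dsum_lift_in mkrowE scale1r. Qed.
Lemma fbaseZ a (r : R) : dsum_in (fun _ : A => R^o) a r = r *: fbase a.
Proof.
have {1}-> : (r : R^o) = r *: (1 : R^o) by rewrite /GRing.scale /= mulr1.
by rewrite linearZ.
Qed.
Lemma free_eq_lin X (f g : {linear free A -> X}) :
  (forall a, f (fbase a) = g (fbase a)) -> forall x, f x = g x.
Proof.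
move=> fg; apply: dsum_eq_lin => a r.
by rewrite fbaseZ !linearZ /= -[in LHS]/(fbase a) fg.
Qed.
End Free.

End Modules.

(** * Nakayama's lemma *)

Section Jacobson.
Variable R : pzRingType.
Implicit Types (c d r s u v : R) (M : lmodType R).

(** The Jacobson radical, described elementwise. *)
Definition jac c : Prop := forall r, exists u, u * (1 - r * c) = 1.

(** The left inverse u equals 1 - (-u)c, so it has a left inverse too, which must be 1 - c. *)
Lemma jac_inv c : jac c -> exists u, u * (1 - c) = 1 /\ (1 - c) * u = 1.
Proof.
move=> Jc; have [u uE] := Jc 1; rewrite mul1r in uE.
have uc : u = 1 - (- u) * c.
  by rewrite mulNr opprK -uE mulrBr mulr1 subrK.
have [v vE] := Jc (- u); rewrite -uc in vE.
have v1 : v = 1 - c by rewrite -[v]mulr1 -[X in v * X]uE mulrA vE mul1r.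
exists u; split; [exact: uE | by rewrite -v1].
Qed.

Lemma jacMl r c : jac c -> jac (r * c).
Proof. by move=> Jc s; have [u uE] := Jc (s * r); exists u; rewrite mulrA. Qed.

(** The passage of invertibility from 1 - ab to 1 - ba, with a = s and b = rc: if v inverts 1 - src,
    then 1 + rcvs inverts 1 - rcs. *)
Lemma jacMr c s : jac c -> jac (c * s).
Proof.
move=> Jc r; have [v [vE _]] := jac_inv (jacMl (s * r) Jc).
exists (1 + r * c * v * s).
have -> : (1 + r * c * v * s) * (1 - r * (c * s))
   = 1 - r * c * s + r * c * (v * (1 - s * r * c)) * s.
  by rewrite mulrDl mul1r !mulrBr mulr1 !mulrBl !mulrA mulr1.
by rewrite vE mulr1 subrK.
Qed.

(** If u inverts 1 - rc on the left, then u(1 - r(c + d)) = 1 - urd, which is again left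
    invertible. *)
Lemma jacD c d : jac c -> jac d -> jac (c + d).
Proof.
move=> Jc Jd r; have [u uE] := Jc r; have [v vE] := Jd (u * r).
exists (v * u).
by rewrite -mulrA (mulrDr r) opprD addrA (mulrBr u) uE mulrA.
Qed.

(** Gaussian elimination: the last diagonal coefficient c is in the radical, so 1 - c has an inverse
    u and the last unknown can be solved for. Substituting it leaves a smaller system whose
    coefficients c_ij + c_in u c_nj still lie in the radical. *)
Lemma nakayama M n (c : 'I_n -> 'I_n -> R) (y : 'I_n -> M) :
  (forall i j, jac (c i j)) -> (forall i, y i = \sum_j c i j *: y j) ->
  forall i, y i = 0.
Proof.
elim: n c y => [|n IHn] c y Jc yE; first by case.
have [u [uE _]] := jac_inv (Jc ord_max ord_max).
have y_last : y ord_max = \sum_(j < n) (u * c ord_max (widen_ord (leqnSn n) j)) *: y (widen_ord (leqnSn n) j).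
  have := yE ord_max; rewrite big_ord_recr /= => /eqP; rewrite -subr_eq => /eqP yl.
  rewrite -[LHS]scale1r -uE -scalerA scalerBl scale1r yl scaler_sumr.
  by apply: eq_bigr => j _; rewrite scalerA.
have y0 i : y (widen_ord (leqnSn n) i) = 0.
  pose w := widen_ord (leqnSn n).
  apply: (IHn (fun i j => c (w i) (w j) + c (w i) ord_max * u * c ord_max (w j))
    (y \o w)) => {}i; first by move=> j; apply: jacD => //; apply: jacMr; apply: jacMr.
  rewrite /= {1}yE big_ord_recr /= y_last scaler_sumr -big_split.
  by apply: eq_bigr => j _; rewrite /= scalerA scalerDl mulrA.
move=> i; have [j ->|->//] := unliftP ord_max i.
  have -> : lift ord_max j = widen_ord (leqnSn n) j by apply: val_inj; rewrite /= /bump leqNgt ltn_ord.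
  exact: y0.
by rewrite y_last big1 // => j _; rewrite y0 scaler0.
Qed.

(* Nakayama's lemma for right modules, with the annihilator of Y in place of a
   right submodule. *)
Lemma nakayama_row (Y : lmodType R) n (c : 'I_n -> 'I_n -> R) (a : 'I_n -> R) :
  (forall i j, jac (c i j)) ->
  (forall j (y : Y), a j *: y = \sum_i (a i * c i j) *: y) ->
  forall j (y : Y), a j *: y = 0.
Proof.
elim: n c a => [|n IHn] c a Jc aE; first by case.
have [u [_ uE]] := jac_inv (Jc ord_max ord_max).
pose w := widen_ord (leqnSn n).
have a_last (y : Y) : a ord_max *: y = \sum_(i < n) (a (w i) * c (w i) ord_max * u) *: y.
  have := aE ord_max (u *: y); rewrite big_ord_recr /= => /eqP.
  rewrite -subr_eq -scalerBl -{1}[a ord_max]mulr1 -mulrBr scalerA -mulrA uE mulr1 => /eqP ->.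
  by apply: eq_bigr => i _; rewrite scalerA.
have a0 j (y : Y) : a (w j) *: y = 0.
  apply: (IHn (fun i j => c (w i) (w j) + c (w i) ord_max * u * c ord_max (w j))
    (a \o w)) => {}j; first by move=> i; apply: jacD => //; apply: jacMr; apply: jacMr.
  move=> {}y; rewrite /= {1}aE big_ord_recr /=.
  rewrite -[(a _ * c _ _) *: y in X in _ + X]scalerA a_last -big_split.
  by apply: eq_bigr => i _; rewrite /= scalerA mulrDr scalerDl !mulrA.
move=> j y; have [i ->|->] := unliftP ord_max j.
  have -> : lift ord_max i = w i by apply: val_inj; rewrite /= /bump leqNgt ltn_ord.
  exact: a0.
rewrite a_last big1 // => i _.
by rewrite -!mulrA -scalerA a0.
Qed.

End Jacobson.

(** * The action of an ideal and its torsion pair *)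

Section IdealAction.
Variables (R : pzRingType) (I : submodClosed R^o).
Implicit Types M N X Y P : lmodType R.

Lemma idealD (a b : R) : (a : R^o) \in I -> (b : R^o) \in I -> (a + b : R^o) \in I.
Proof. exact: rpredD. Qed.

Lemma idealM (r a : R) : (a : R^o) \in I -> (r * a : R^o) \in I.
Proof. by move=> Ia; have : r *: (a : R^o) \in I by apply: rpredZ. Qed.

Lemma ideal_smulE M (N : set M) x : ideal_smul I N x <->
  addspan [set y | exists (a : R) m, [/\ (a : R^o) \in I, N m & y = a *: m]]%classic x.
Proof.
split=> [[n [a [m [Ia Nm ->]]]]|].
  by exists n, (fun i => a i *: m i); split=> // i; exists (a i), (m i).
move=> [n [g [Gg ->]]].
have [a aP] := choice Gg; have [m mP] := choice aP.
exists n, a, m; split=> [i|i|]; try by case: (mP i).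
by apply: eq_bigr => i _; case: (mP i).
Qed.

Lemma ideal_smul_mem M (N : set M) (a : R) m : (a : R^o) \in I -> N m -> ideal_smul I N (a *: m).
Proof. by move=> Ia Nm; apply/ideal_smulE/addspan_mem; exists a, m. Qed.

Lemma ideal_smul0 M (N : set M) : ideal_smul I N 0.
Proof. exact/ideal_smulE/addspan0. Qed.

Lemma ideal_smulD M (N : set M) x y :
  ideal_smul I N x -> ideal_smul I N y -> ideal_smul I N (x + y).
Proof. by move=> /ideal_smulE Nx /ideal_smulE Ny; apply/ideal_smulE/addspanD. Qed.

Lemma ideal_smul_ind M (N : set M) (P : M -> Prop) :
  P 0 -> (forall x y, P x -> P y -> P (x + y)) ->
  (forall (a : R) m, (a : R^o) \in I -> N m -> P (a *: m)) ->
  forall x, ideal_smul I N x -> P x.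
Proof.
move=> P0 PD PG x /ideal_smulE; apply: addspan_ind => // y [a [m [Ia Nm ->]]].
exact: PG.
Qed.

Lemma ideal_smulZ M (N : set M) r x : ideal_smul I N x -> ideal_smul I N (r *: x).
Proof.
move: x; apply: ideal_smul_ind => [|x y|a m Ia Nm]; first by rewrite scaler0; apply: ideal_smul0.
  by rewrite scalerDr; apply: ideal_smulD.
by rewrite scalerA; apply: ideal_smul_mem => //; apply: idealM.
Qed.

Lemma ideal_smul_map M X (f : {linear M -> X}) (N : set M) (N' : set X) x :
  (forall m, N m -> N' (f m)) -> ideal_smul I N x -> ideal_smul I N' (f x).
Proof.
move=> NN'; move: x; apply: ideal_smul_ind => [|x y|a m Ia Nm].
- by rewrite linear0; apply: ideal_smul0.
- by rewrite linearD; apply: ideal_smulD.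
by rewrite linearZ; apply: ideal_smul_mem => //; apply: NN'.
Qed.

Lemma C_classP M : C_class I M <-> forall x : M, ideal_smul I setT x.
Proof.
split=> [CM x|CM]; first by rewrite (CM : ideal_smul I setT = setT).
by apply/seteqP; split=> x // _; apply: CM.
Qed.

Lemma T_classP M : T_class I M <-> forall (a : R) (x : M), (a : R^o) \in I -> a *: x = 0.
Proof.
split=> [TM a x Ia|TM].
  have : ideal_smul I setT (a *: x) by apply: ideal_smul_mem.
  by rewrite (TM : ideal_smul I setT = [set 0]%classic).
apply/seteqP; split=> x; last by move=> ->; apply: ideal_smul0.
move: x; apply: ideal_smul_ind => //= [x y -> ->|a x Ia _]; first by rewrite addr0.
exact: TM.
Qed.

Lemma C_T_hom0 M N : C_class I M -> T_class I N -> hom_zero M N.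
Proof.
move=> /C_classP CM /T_classP TN f x; have := CM x.
move: x; apply: ideal_smul_ind => [|x y|a m Ia _]; rewrite ?linear0 //.
  by rewrite linearD => -> ->; rewrite addr0.
by rewrite linearZ; apply: TN.
Qed.

Definition ISM M : submodClosed M :=
  mksub (@ideal_smul0 M setT) (@ideal_smulD M setT) (@ideal_smulZ M setT).
Lemma ISMP M (x : M) : (x \in ISM M) <-> ideal_smul I setT x.
Proof. exact: mksubP. Qed.

Lemma T_class_quotISM M : T_class I (quotmod (ISM M)).
Proof.
apply/T_classP => a x Ia; have [y <-] := quotpi_epi x.
by rewrite -linearZ; apply/quotpi_eq0/ISMP; apply: ideal_smul_mem.
Qed.

Lemma C_class_epi M N (f : {linear M -> N}) : epi f -> C_class I M -> C_class I N.
Proof.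
move=> fe /C_classP CM; apply/C_classP => y; have [x <-] := fe y.
exact: ideal_smul_map (CM x).
Qed.

Lemma C_class_dsum (J : choiceType) (M : J -> lmodType R) :
  (forall j, C_class I (M j)) -> C_class I (dsum M).
Proof.
move=> CM; apply/C_classP; apply: dsum_ind => [|x y|j x].
- exact: ideal_smul0.
- exact: ideal_smulD.
by apply: ideal_smul_map ((C_classP _).1 (CM j) x).
Qed.

Section Idempotent.
Hypotheses (I_two_sided : two_sided I) (I_idempotent : idempotent_ideal I).

(** The form in which idempotence of I is used: elements of I are sums of products of two elements
    of I. *)
Lemma idem_ind (P : R -> Prop) :
  P 0 -> (forall x y, P x -> P y -> P (x + y)) ->
  (forall a b : R, (a : R^o) \in I -> (b : R^o) \in I -> P (a * b)) ->
  forall x : R, (x : R^o) \in I -> P x.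
Proof.
move=> P0 PD PM x Ix; have : [set` I]%classic (x : R^o) by [].
by rewrite -I_idempotent; move: x {Ix}; apply: (@ideal_smul_ind R^o [set` I]%classic P).
Qed.

Lemma C_class_ISM M : C_class I (submod (ISM M)).
Proof.
apply/C_classP => -[x Nx].
(* The induction runs over elements of M and builds the lift to the submodule as it goes; an element
   (ab)m is lifted as a(bm), with bm already in IM. *)
have: forall x, ideal_smul I setT x -> exists y : submod (ISM M), val y = x /\ ideal_smul I setT y.
  apply: ideal_smul_ind => [|u v|a m Ia _].
  - by exists 0; split=> //; exact: ideal_smul0.
  - move=> [y [<- Iy]] [z [<- Iz]]; exists (y + z); split=> //; exact: ideal_smulD.
  move: a Ia; apply: idem_ind => [|a b|a b Ia Ib].
  - by exists 0; split; [rewrite scale0r | exact: ideal_smul0].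
  - move=> [y [yE Iy]] [z [zE Iz]]; exists (y + z); split; last exact: ideal_smulD.
    by rewrite scalerDl -yE -zE.
  have Nbm : b *: m \in ISM M by apply/ISMP; apply: ideal_smul_mem.
  exists (a *: (Sub (b *: m) Nbm : submod (ISM M))); split; first by rewrite -scalerA.
  exact: ideal_smul_mem.
move=> /(_ x ((ISMP _).1 Nx)) [y [yx Iy]].
by have -> : exist _ x Nx = y by apply: val_inj.
Qed.

(** The test objects are M/IM, which is killed by I, and IM, which satisfies I(IM) = IM by
    idempotence. *)
Lemma C_T_torsion_pair : torsion_pair (C_class I) (T_class I).
Proof.
split=> M; split=> [CM N ?|H]; try exact: C_T_hom0.
  apply/C_classP => x; apply/ISMP/quotpi_eq0.
  exact: H (T_class_quotISM M) (quotpi (ISM M)) x.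
apply/T_classP => a x Ia.
have Nax : a *: x \in ISM M by apply/ISMP; apply: ideal_smul_mem.
exact: H (C_class_ISM M) (subinj (ISM M)) (Sub (a *: x) Nax).
Qed.

End Idempotent.
End IdealAction.

(** * The idempotent of a semiperfect ring *)

Section Projectives.
Variable R : pzRingType.
Implicit Types M N P Q X Y : lmodType R.

Lemma projective_ring : projective (R^o : lmodType R).
Proof.
move=> M N g f ge; have [m mE] := ge (f 1).
exists (mkrow m) => r; rewrite mkrowE linearZ mE -linearZ.
by congr (f _); rewrite /GRing.scale /= mulr1.
Qed.

Lemma projective_retract P Q (i : {linear P -> Q}) (r : {linear Q -> P}) :
  (forall x, r (i x) = x) -> projective Q -> projective P.
Proof.
move=> ri PQ M N g f ge; have [h hE] := PQ M N g (f \o r) ge.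
by exists (h \o i) => x; rewrite /= -hE /= ri.
Qed.

Lemma projective_dsum (J : choiceType) (M : J -> lmodType R) :
  (forall j, projective (M j)) -> projective (dsum M).
Proof.
move=> PM N N' g f ge.
have hP j : {h : {linear M j -> N} | forall x, f (dsum_in M j x) = g (h x)}.
  by apply: cid; apply: (PM j _ _ g (f \o dsum_in M j)).
exists (dsum_lift (fun j => sval (hP j))) => x.
apply: (@dsum_eq_lin _ _ _ _ f (g \o dsum_lift (fun j => sval (hP j)))) => j {}x.
change (f (dsum_in M j x) = g (dsum_lift (fun j => sval (hP j)) (dsum_in M j x))).
by rewrite dsum_lift_in; case: (hP j).
Qed.

(** The free module on the underlying set of P maps onto P and splits; the coordinates of the
    section form the dual basis, indexed by P itself. *)
Lemma dual_basis P : projective P -> exists phi : P -> {linear P -> R^o},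
  forall x, exists n (p : 'I_n -> P), x = \sum_(i < n) (phi (p i) x : R) *: p i.
Proof.
move=> PP; pose fl := @flift R P P id.
have fle : epi fl by move=> x; exists (@fbase R P x); rewrite flift_base.
have [s sE] := PP _ _ fl idfun fle.
exists (fun p => dsum_proj (fun _ : P => (R^o : lmodType R)) p \o s) => x.
have [r [ur rE]] := dsum_supp (s x).
exists (size r), (fun i => nth 0 r i).
rewrite {1}[x]sE (dsum_decomp ur rE) linear_sum (big_nth 0) big_mkord.
by apply: eq_bigr => i _; rewrite [LHS]dsum_lift_in.
Qed.

End Projectives.

Section Pivot.
Variables (R : pzRingType) (I : submodClosed R^o).
Hypotheses (I_two_sided : two_sided I).
Implicit Types M N P Q X Y : lmodType R.

Lemma ideal_of_smul (x : R^o) : @ideal_smul R I R^o setT x -> x \in I.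
Proof.
move: x; apply: ideal_smul_ind => [|x y|a m Ia _]; [exact: rpred0|exact: rpredD|].
exact: I_two_sided.
Qed.

(** For a in I and m = sum_i b_i g_i, the coefficients a b_i of am remain in I because I is
    two-sided. *)
Lemma ideal_smul_coef M n (g : 'I_n -> M) x :
  (forall x, exists a : 'I_n -> R, x = \sum_(i < n) a i *: g i) ->
  ideal_smul I setT x ->
  exists b : 'I_n -> R, (forall i, (b i : R^o) \in I) /\ x = \sum_(i < n) b i *: g i.
Proof.
move=> gP; move: x; apply: ideal_smul_ind => [|x y [a [Ia ->]] [b [Ib ->]]|a m Ia _].
- by exists (fun=> 0); split=> [i|]; [exact: rpred0 | rewrite big1 // => i _; rewrite scale0r].
- exists (fun i => a i + b i); split=> [i|]; first exact: idealD.
  by rewrite -big_split; apply: eq_bigr => i _; rewrite scalerDl.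
have [b ->] := gP m; exists (fun i => a * b i); split=> [i|]; first exact: I_two_sided.
by rewrite scaler_sumr; apply: eq_bigr => i _; rewrite scalerA.
Qed.

Section Idem.
Variable e : R.
Hypothesis e_jac : forall x : R, (x : R^o) \in I -> jac (x * (1 - e)).

(** This exchange brings the coefficients from I into the radical. *)
Lemma killed_scale Y (a : R) (y : Y) : (forall y : Y, e *: y = 0) -> (a * (1 - e)) *: y = a *: y.
Proof. by move=> eY; rewrite mulrBr mulr1 scalerBl -scalerA eY scaler0 subr0. Qed.

Lemma killed_gens Y n (y : 'I_n -> Y) (b : 'I_n -> 'I_n -> R) :
  (forall z : Y, e *: z = 0) -> (forall i j, (b i j : R^o) \in I) ->
  (forall i, y i = \sum_(j < n) b i j *: y j) -> forall i, y i = 0.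
Proof.
move=> eY Ib yE; apply: (@nakayama _ _ _ (fun i j => b i j * (1 - e))) => [i j|i].
  exact: e_jac.
by rewrite {1}yE; apply: eq_bigr => j _; rewrite killed_scale.
Qed.

Lemma killed_fg M Y : finitely_generated M -> C_class I M ->
  (forall y : Y, e *: y = 0) -> hom_zero M Y.
Proof.
move=> [n [g gP]] /C_classP CM eY f.
have /choice[b bP] i := ideal_smul_coef gP (CM (g i)).
have fg0 : forall i, f (g i) = 0.
  apply: (@killed_gens _ _ _ b) => // [i|i]; first by case: (bP i).
  case: (bP i) => _ gE; rewrite {1}gE linear_sum.
  by apply: eq_bigr => j _; rewrite linearZ.
move=> x; have [a ->] := gP x.
by rewrite linear_sum big1 // => i _; rewrite linearZ /= fg0 scaler0.
Qed.

(** Write x = sum_i a_i p_i with a_i = phi_i(x). Applying phi_j gives a_j = sum_i a_i phi_j(p_i),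
    where phi_j(p_i) is in I because P = IP. The row form of Nakayama's lemma makes every a_j act as
    zero on Y, hence f(x) = 0. *)
Lemma killed_projective P Y : projective P -> C_class I P ->
  (forall y : Y, e *: y = 0) -> hom_zero P Y.
Proof.
move=> /dual_basis[phi phiP] /C_classP CP eY f x.
have Iphi p z : (phi p z : R^o) \in I.
  by apply: ideal_of_smul; apply: ideal_smul_map (CP z).
have [n [p xE]] := phiP x.
have a0 : forall j (y : Y), (phi (p j) x : R) *: y = 0.
  apply: (@nakayama_row _ Y n (fun i j => (phi (p j) (p i) : R) * (1 - e))
    (fun i => phi (p i) x)) => [i j|j y]; first exact: e_jac.
  rewrite {1}xE linear_sum scaler_suml; apply: eq_bigr => i _.
  by rewrite mulrA killed_scale // linearZ.
by rewrite xE linear_sum big1 // => i _; rewrite linearZ /= a0.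
Qed.

End Idem.

Lemma ring_quot_fg : finitely_generated (quotmod I).
Proof.
exists 1%N, (fun=> quotpi I 1) => x; have [r <-] := quotpi_epi x.
exists (fun=> r); rewrite big_ord1 -linearZ; congr (quotpi I _).
by rewrite /GRing.scale /= mulr1.
Qed.

Lemma fg_epi M N (f : {linear M -> N}) : epi f -> finitely_generated M -> finitely_generated N.
Proof.
move=> fe [n [g gP]]; exists n, (f \o g) => y; have [x <-] := fe y.
have [a ->] := gP x; exists a; rewrite linear_sum; apply: eq_bigr => i _.
exact: linearZ.
Qed.

(* R = Q0 + Re with Q0 the projective cover of R/I: e lies in I, and what is
   left of I lies in the superfluous kernel of Q0 -> R/I. *)
Lemma semiperfect_idempotent : semiperfect R -> exists e : R,
  [/\ (e : R^o) \in I, e * e = e &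
      forall x : R, (x : R^o) \in I -> jac (x * (1 - e))].
Proof.
move=> sR; have [Q0 [p [PQ0 pe sup]]] := sR _ ring_quot_fg.
have [h hE] := projective_ring (quotpi I) pe.
have he : epi h.
  pose L : submodClosed Q0 := im_sub h.
  move=> q; suff: q \in L by rewrite inE.
  apply: sup => {}q; have [r rE] := quotpi_epi (p q).
  exists (q - h r), (h r); split; last by rewrite subrK.
  - by rewrite /= linearB -hE rE subrr.
  - by rewrite inE; exists r.
have [s sE] := PQ0 _ _ h idfun he.
(* The idempotent of the summand s(Q0) = Rf; its complement is the required e. *)
pose f : R := s (h 1).
have shE (r : R) : s (h (r : R^o)) = r * f :> R.
  have {1}-> : (r : R^o) = r *: (1 : R^o) by rewrite /GRing.scale /= mulr1.
  by rewrite !linearZ.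
have ff : f * f = f by rewrite -shE /f -(sE (h 1)).
exists (1 - f); split.
- have : quotpi I 1 = quotpi I f by rewrite hE [RHS]hE /f -(sE (h 1)).
  by move/quotpi_eq.
- by rewrite mulrBr mulr1 mulrBl mul1r ff subrr subr0.
move=> x Ix; rewrite opprB addrC subrK => r.
have phx : p (h (x : R^o)) = 0 by rewrite -hE; apply/quotpi_eq0.
pose L : submodClosed R^o := im_sub (mkrow (1 - r * (x * f) : R^o)).
have LP (y : R^o) : y \in L -> exists v : R, v * (1 - r * (x * f)) = y by rewrite inE.
pose L' : submodClosed Q0 := mksub (G := [set q | s q \in L]%classic)
   (ltac:(by rewrite /= linear0; apply: rpred0))
   (ltac:(by move=> u v /= Lu Lv; rewrite linearD; apply: rpredD))
   (ltac:(by move=> a v /= Lv; rewrite linearZ; apply: rpredZ)).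
have sL q : s q \in L.
  suff : q \in L' by move/mksubP.
  apply: sup => {}q; pose v : R := s q.
  exists (h (v * r * x : R)), (q - h (v * r * x : R)); split; last by rewrite addrC subrK.
    by rewrite /= -hE; apply/quotpi_eq0; apply: idealM.
  apply/mksubP; rewrite /= linearB [X in _ - X]shE inE; exists v.
  by rewrite mkrowE /GRing.scale /= mulrBr mulr1 !mulrA.
suff /LP[u uE] : (1 : R^o) \in L by exists u.
rewrite -[1](subrK (r * (x * f) : R^o)) rpredD //.
  by rewrite inE; exists 1; rewrite mkrowE scale1r.
by rewrite mulrA -shE.
Qed.

Definition ReR_gens (e : R) : set R^o := [set x | exists a b : R, x = a * e * b]%classic.

Section ReR.
Variable e : R.
Lemma ReR_Z (a : R) (x : R^o) : addspan (ReR_gens e) x -> addspan (ReR_gens e) (a *: x).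
Proof.
move: x; apply: addspan_ind => [|x y|_ [b [c ->]]]; rewrite ?scaler0 ?scalerDr.
- exact: addspan0.
- exact: addspanD.
by apply: addspan_mem; exists (a * b), c; rewrite /GRing.scale /= !mulrA.
Qed.

Definition ReR : submodClosed R^o :=
  mksub (addspan0 (ReR_gens e)) (@addspanD _ (ReR_gens e)) ReR_Z.

Lemma ReRP (x : R^o) : (x \in ReR) <-> addspan (ReR_gens e) x.
Proof. exact: mksubP. Qed.

(** The pivot of all equivalences, I = ReR for an idempotent e; the inclusion of ReR in I follows
    from e in I, as I is two-sided. *)
Definition full_idempotent : Prop :=
  [/\ (e : R^o) \in I, e * e = e & forall x : R, (x : R^o) \in I -> (x : R^o) \in ReR].

Lemma full_idempotent_test : (e : R^o) \in I -> e * e = e ->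
  (forall Y : lmodType R, (forall y : Y, e *: y = 0) -> T_class I Y) -> full_idempotent.
Proof.
move=> Ie ee test; split=> // x Ix.
have /T_classP TY : T_class I (quotmod ReR).
  apply: test => y; have [r <-] := quotpi_epi y.
  rewrite -linearZ; apply/quotpi_eq0/ReRP/addspan_mem.
  by exists 1, r; rewrite mul1r.
have := TY _ (quotpi ReR 1) Ix; rewrite -linearZ => /quotpi_eq0.
by rewrite /GRing.scale /= mulr1.
Qed.
End ReR.

Lemma T_class_epi M N (f : {linear M -> N}) : epi f -> T_class I M -> T_class I N.
Proof.
move=> fe /T_classP TM; apply/T_classP => a y Ia; have [x <-] := fe y.
by rewrite -linearZ TM // linear0.
Qed.

Lemma T_class_quot : T_class I (quotmod I).
Proof.
apply/T_classP => a y Ia; have [x <-] := quotpi_epi y.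
by rewrite -linearZ; apply/quotpi_eq0; apply: I_two_sided.
Qed.

(** A module killed by I is a quotient of copies of R/I indexed by its own elements. *)
Lemma Gen_quot X : Gen (quotmod I) X <-> T_class I X.
Proof.
split=> [[A [f fe]]|TX].
  apply: T_class_epi fe _; apply/T_classP => a x Ia; apply: dsumP => j.
  exact: ((T_classP _ _).1 T_class_quot).
have kill (x : X) (a : R^o) : a \in I -> mkrow x a = 0.
  by move=> Ia; apply: ((T_classP _ _).1 TX).
exists X, (dsum_lift (fun x => quotlift (kill x))) => x.
exists (dsum_in _ x (quotpi I 1)).
by rewrite dsum_lift_in quotliftE mkrowE scale1r.
Qed.

Variable e : R.
Hypotheses (Ie : (e : R^o) \in I) (ee : e * e = e).
Hypothesis e_jac : forall x : R, (x : R^o) \in I -> jac (x * (1 - e)).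

(** Dual basis coordinates lie in the trace, so P = IP and P has no nonzero map to Y. An element of
    I is a sum of values f_i(x_i), and f_i followed by multiplication onto y is such a map. *)
Lemma full_of_trace P : projective P -> trace P = [set` I]%classic -> full_idempotent e.
Proof.
move=> PP trP; apply: full_idempotent_test => // Y eY.
have trI (x : R^o) : trace P x <-> x \in I by rewrite trP.
have [phi phiP] := dual_basis PP.
have CP : C_class I P.
  apply/C_classP => x; have [n [p ->]] := phiP x.
  apply/ideal_smulE/addspan_sum => i; apply: addspan_mem.
  exists (phi (p i) x), (p i); split=> //; apply/trI.
  by exists 1%N, (fun=> phi (p i)), (fun=> x); rewrite big_ord1.
have hom0 := killed_projective e_jac PP CP eY.
apply/T_classP => a y /trI[n [f [x ->]]].
rewrite scaler_suml big1 // => i _; exact: (hom0 (mkrow y \o f i)).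
Qed.

(** By idempotence IY belongs to C_I, hence is generated by the M_j; but every composite from M_j
    through IY to Y is zero. *)
Lemma full_of_gen (J : choiceType) (M : J -> lmodType R) :
  idempotent_ideal I ->
  (forall j, finitely_generated (M j) /\ C_class I (M j)) ->
  (forall N, Gen (dsum M) N <-> C_class I N) -> full_idempotent e.
Proof.
move=> idI MP GM; apply: full_idempotent_test => // Y eY.
have [A [f fe]] := (GM _).2 (C_class_ISM idI Y).
apply/T_classP => a y Ia.
have Nay : a *: y \in ISM I Y by apply/ISMP; apply: ideal_smul_mem.
have [x xE] := fe (Sub (a *: y) Nay).
have f0 : forall x, f x = \0 x.
  apply: dsum_eq_lin => j v; apply: (@dsum_eq_lin _ _ _ _ (f \o dsum_in _ j) \0) => k w.
  apply: val_inj.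
  have [fgM CM] := MP k.
  exact: (killed_fg e_jac fgM CM eY (subinj (ISM I Y) \o (f \o (dsum_in _ j \o dsum_in M k)))).
by have := congr1 val xE; rewrite f0.
Qed.

End Pivot.

(** * Silting modules *)

Section Silting.
Variables (R : pzRingType) (I : submodClosed R^o).
Hypotheses (I_two_sided : two_sided I).
Implicit Types M N P Q X Y : lmodType R.

Section FromSilting.
Hypothesis sR : semiperfect R.
Variable e : R.
Hypotheses (Ie : (e : R^o) \in I) (ee : e * e = e).
Hypothesis e_jac : forall x : R, (x : R^o) \in I -> jac (x * (1 - e)).

(* With Q0 the projective cover of Coker s, Q = Q0 + Q1 and P = P0 + Q1, where
   P0 -> Q0 has the same class D and cokernel.  Modulo I it becomes a split
   monomorphism with superfluous image, hence zero, so that P0 = I P0. *)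
Lemma full_of_silting : silting (quotmod I) -> full_idempotent I e.
Proof.
move=> [P [Q [s [PP PQ [phi [psi _ phiK]] DG]]]].
have DT X : T_class I X -> D_class s X by move=> TX; apply/DG/Gen_quot.
have phie : epi phi by move=> y; exists (psi y).
have [Q0 [p [PQ0 pe sup]]] := sR (fg_epi phie (ring_quot_fg I)).
pose pi := quotpi (im_sub s).
have pis x : pi (s x) = 0 by apply/quotpi_eq0; rewrite inE; exists x.
have [h hE] := PQ _ _ p pi pe.
have he : epi h.
  move=> q; suff: q \in im_sub h by rewrite inE.
  apply: sup => {}q; have [x xE] := quotpi_epi (p q).
  exists (q - h x), (h x); split; last by rewrite subrK.
  - by rewrite /= linearB -hE [pi x]xE subrr.
  - by rewrite inE; exists x.
have [t0 t0E] := PQ0 _ _ h idfun he.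
have {}t0E q : h (t0 q) = q by rewrite -t0E.
(* [u] projects Q onto Q1 = ker h, the complement of t0(Q0). Since p h is the cokernel map of s, Q1
   lies in the image of s. *)
have [u uE] : exists u : {linear Q -> Q}, forall x, u x = x - t0 (h x).
  by exists (idfun \- (t0 \o h)).
have hu x : h (u x) = 0 by rewrite uE linearB t0E subrr.
have uu x : u (u x) = u x by rewrite uE hu linear0 subr0.
have ut0 q : u (t0 q) = 0 by rewrite uE t0E subrr.
have u_im x : u x \in im_sub s.
  apply/quotpi_eq0; rewrite -/pi hE hu; exact: linear0.
have s_im x : s x \in im_sub s by rewrite inE; exists x.
have s_epi : epi (corestr s_im).
  move=> -[y yI]; have := yI; rewrite inE => -[x xE].
  by exists x; apply: val_inj.
(* [t] splits s over Q1, so every x in P is the sum of its part [r0 x] in P0 = ker(us) and of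
   tus(x). *)
have [t tE] := PQ _ _ (corestr s_im) (corestr u_im) s_epi.
have {}tE x : s (t x) = u x by have := congr1 val (tE x).
pose P0 : submodClosed P := mksub (G := [set x | u (s x) = 0]%classic)
   (ltac:(by rewrite /= !linear0))
   (ltac:(by move=> x y /= ux uy; rewrite !linearD ux uy addr0))
   (ltac:(by move=> a x /= ux; rewrite !linearZ /= ux scaler0)).
have P0P x : x \in P0 <-> u (s x) = 0 by apply: mksubP.
have [r0 r0E] : exists r0 : {linear P -> P}, forall x, r0 x = x - t (u (s x)).
  by exists (idfun \- (t \o (u \o s))).
have rP0 x : r0 x \in P0.
  by apply/P0P; rewrite r0E !linearB tE !uu subrr.
pose r := corestr rP0.
have rE x : val (r x) = x - t (u (s x)) by rewrite -r0E.
have r_id (x : submod P0) : r (val x) = x.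
  apply: val_inj; rewrite rE.
  have /P0P-> : val x \in P0 by case: x.
  by rewrite linear0 subr0.
have PP0 : projective (submod P0) by apply: (@projective_retract _ _ _ (subinj P0) r).
have IP0 x : x \in P0 -> x \in ISM I P.
  move=> /P0P ux.
  have [g gE] := DT _ (T_class_quotISM I P) (quotpi (ISM I P)).
  (* Modulo I the map hs on P0 acquires a retraction: for z in P0, [rho] takes hs(z) back to the
     class of z. *)
  pose rho := g \o t0.
  have kill z : z \in ISM I P -> (quotpi (ISM I Q0) \o (h \o s)) z = 0.
    move=> /ISMP Iz; apply/quotpi_eq0/ISMP.
    exact: (ideal_smul_map (f := h \o s) _ Iz).
  pose lam := quotlift kill.
  (* Elements of ker p have the form hs(z) with z in P0, and [lam \o rho] sends these to their own
     class; so [th] vanishes on ker p. *)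
  have [th thE] : exists th : {linear Q0 -> quotmod (ISM I Q0)},
      forall q, th q = quotpi (ISM I Q0) q - lam (rho q).
    by exists (quotpi (ISM I Q0) \- (lam \o rho)).
  have t0hs z : u (s z) = 0 -> s z = t0 (h (s z)).
    by move=> /eqP; rewrite uE subr_eq0 => /eqP.
  have rho_hs z : u (s z) = 0 -> rho (h (s z)) = quotpi (ISM I P) z.
    by move=> uz; rewrite gE [in RHS]t0hs.
  have pre q : p q = 0 -> exists z, u (s z) = 0 /\ h (s z) = q.
    move=> pq; have : t0 q \in im_sub s.
      by apply/quotpi_eq0; rewrite -/pi hE t0E.
    by rewrite inE => -[z zE]; exists z; rewrite zE ut0 t0E.
  have th_ker q : p q = 0 -> th q = 0.
    move=> /pre[z [uz <-]]; rewrite thE rho_hs // /lam quotliftE.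
    exact: subrr.
  have lam_im q : exists z, lam (rho q) = quotpi (ISM I Q0) (h (s z)).
    have [z zE] := quotpi_epi (rho q); exists z.
    by rewrite -zE /lam quotliftE.
  have phs z : p (h (s z)) = 0 by rewrite -hE.
  have th_epi q : exists q', th q' = quotpi (ISM I Q0) q.
    pose L : submodClosed Q0 :=
      mksub (G := [set q | exists q', th q' = quotpi (ISM I Q0) q]%classic)
      (ltac:(by exists 0; rewrite !linear0))
      (ltac:(by move=> x1 y1 [x2 E2] [y2 F2]; exists (x2 + y2); rewrite !linearD E2 F2))
      (ltac:(by move=> a x1 [x2 E2]; exists (a *: x2); rewrite !linearZ /= E2)).
    suff: q \in L by move/mksubP.
    apply: sup => {}q; have [z zE] := lam_im q.
    exists (h (s z)), (q - h (s z)); split=> //; last by rewrite addrC subrK.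
    by apply/mksubP; exists q; rewrite linearB -zE.
  have TI : T_class I (coker s) := T_class_epi phie (T_class_quot I_two_sided).
  have pI z : z \in ISM I Q0 -> p z = 0.
    move=> /ISMP Iz; have := ideal_smul_map (f := p) (fun _ _ => Logic.I : setT _) Iz.
    by rewrite (TI : ideal_smul I setT = [set 0]%classic).
  (* If [th q'] is the class of q, then p(q') = p(q) = 0, so [th q'] is zero and q lies in I Q0. *)
  have ker_I q : p q = 0 -> q \in ISM I Q0.
    move=> pq; apply/quotpi_eq0; have [q' q'E] := th_epi q.
    rewrite -q'E; apply: th_ker.
    have [z zE] := lam_im q'.
    have : quotlift pI (th q') = p q' by rewrite thE linearB zE !quotliftE phs subr0.
    by rewrite q'E quotliftE pq.
  apply/quotpi_eq0; rewrite -rho_hs //.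
  have /ISMP Ik := ker_I _ (phs x).
  have := ideal_smul_map (f := rho) (fun _ _ => Logic.I : setT _) Ik.
  by rewrite (T_class_quotISM I P : ideal_smul I setT = [set 0]%classic).
have CP0 : C_class I (submod P0).
  apply/C_classP => x; rewrite -[x]r_id.
  have /IP0/ISMP Ix : val x \in P0 by case: x.
  exact: ideal_smul_map Ix.
apply: full_idempotent_test => // Y eY; apply/Gen_quot => //; apply/DG => f.
have f0 := killed_projective I_two_sided e_jac PP0 CP0 eY (f \o subinj P0).
exists (f \o (t \o u)) => x.
(* f vanishes on the component of x in P0, so f = ftus factors through s. *)
rewrite -[x in LHS](subrK (t (u (s x)))) linearD.
by rewrite -rE [f (val _)](f0 (r x)) add0r.
Qed.

End FromSilting.

Variable e : R.
Hypothesis full_e : full_idempotent I e.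

Definition Re : submodClosed R^o := im_sub (mkrow (e : R^o)).

Lemma ReP (x : R^o) : (x \in Re) <-> (x : R) * e = x.
Proof.
rewrite inE; split=> [[y <-]|xe]; last by exists x.
by case: full_e => _ ee _; rewrite mkrowE /GRing.scale /= -mulrA ee.
Qed.

Lemma e_in_Re : (e : R^o) \in Re.
Proof. by apply/ReP; case: full_e. Qed.

Definition e_Re : submod Re := Sub (e : R^o) e_in_Re.

Lemma Re_gen (x : submod Re) : x = (val x : R) *: e_Re.
Proof. by apply: val_inj; rewrite linearZ /=; apply: esym; apply/ReP; case: x. Qed.

Lemma fg_Re : finitely_generated (submod Re).
Proof.
by exists 1%N, (fun=> e_Re) => x; exists (fun=> val x : R); rewrite big_ord1 -Re_gen.
Qed.

Lemma projective_Re : projective (submod Re).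
Proof.
have re (x : R^o) : mkrow (e : R^o) x \in Re by rewrite inE; exists x.
apply: (@projective_retract _ _ _ (subinj Re) (corestr re)); last exact: projective_ring.
by move=> x; apply: val_inj; apply/ReP; case: x.
Qed.

Lemma C_class_Re : C_class I (submod Re).
Proof.
have [Ie ee _] := full_e; apply/C_classP => x; rewrite (Re_gen x).
have -> : e_Re = e *: e_Re by apply: val_inj; rewrite linearZ /= /GRing.scale /= ee.
by rewrite scalerA; apply: ideal_smul_mem => //; apply: idealM.
Qed.

Definition Re_map M (m : M) : {linear submod Re -> M} := mkrow m \o subinj Re.
Lemma Re_mapE M (m : M) x : Re_map m x = (val x : R) *: m.
Proof. by []. Qed.

Lemma ideal_killed Y : (forall y : Y, e *: y = 0) -> T_class I Y.
Proof.
move=> eY; apply/T_classP => a y; have [_ _ h] := full_e; move=> /h/ReRP.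
move: a; apply: addspan_ind => [|a b|_ [a [b ->]]]; rewrite ?scale0r ?scalerDl //.
  by move=> -> ->; rewrite addr0.
by rewrite -2!scalerA eY scaler0.
Qed.

(** The product aeb is the image of ae under right multiplication by b, a map from Re to R. *)
Lemma trace_Re : trace (submod Re) = [set` I]%classic.
Proof.
have [Ie ee h] := full_e; apply/seteqP; split=> x.
  move=> [n [f [y ->]]]; apply: rpred_sum => i _.
  by apply: (ideal_of_smul I_two_sided); apply: ideal_smul_map ((C_classP _ _).1 C_class_Re (y i)).
move=> /h/ReRP[n [g [gP ->]]].
have [a aP] := choice gP; have [b bP] := choice aP.
exists n, (fun i => Re_map (b i : R^o)), (fun i => a i *: e_Re).
by apply: eq_bigr => i _; rewrite Re_mapE linearZ /=.
Qed.

(** Each aebm is the image of ae in the copy of Re indexed by the element bm of N. *)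
Lemma Gen_Re (N : lmodType R) : Gen (dsum (fun _ : unit => (submod Re : lmodType R))) N <-> C_class I N.
Proof.
split=> [[A [f fe]]|CN].
  apply: (C_class_epi fe); apply: C_class_dsum => _; apply: C_class_dsum => _.
  exact: C_class_Re.
pose f := dsum_lift (fun x : N => dsum_lift (fun _ : unit => Re_map x)).
exists N, f => y; suff : y \in im_sub f by rewrite inE.
have := (C_classP _ _).1 CN y; move: y.
apply: ideal_smul_ind => [|x y|a m Ia _]; [exact: rpred0|exact: rpredD|].
have [_ _ /(_ _ Ia)/ReRP] := full_e; move: a {Ia}.
apply: addspan_ind => [|a b Ia Ib|_ [a [b ->]]].
- by rewrite scale0r; apply: rpred0.
- by rewrite scalerDl; apply: rpredD.
rewrite inE; exists (dsum_in _ (b *: m) (dsum_in _ tt (a *: e_Re))).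
by rewrite /f !dsum_lift_in Re_mapE linearZ /= scalerA.
Qed.

(** The copies of Re indexed by [Some r] map to R by right multiplication by r and together have
    image ReR = I. The extra copy [None] is sent to zero: extending a map from it along s forces
    Hom(Re, X) = 0, that is eX = 0, for every X in the class D. Conversely, Hom(P, X) = 0 when IX =
    0, because P = IP. *)
Lemma silting_of_full : silting (quotmod I).
Proof.
pose P := dsum (fun _ : option R => (submod Re : lmodType R)).
pose s : {linear P -> R^o} :=
  dsum_lift (fun o : option R => Re_map (if o is Some r then (r : R^o) else 0)).
have PP : projective P by apply: projective_dsum => _; exact: projective_Re.
have [Ie ee h] := full_e.
have sI x : s x \in I.
  apply: (ideal_of_smul I_two_sided); apply: ideal_smul_map ((C_classP _ _).1 _ x) => //.
  by apply: C_class_dsum => _; exact: C_class_Re.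
have imI x : (x \in im_sub s) = (x \in I).
  apply/idP/idP; first by rewrite inE => -[y <-].
  move=> /h/ReRP; move: x; apply: addspan_ind => [|x y|_ [a [b ->]]]; [exact: rpred0|exact: rpredD|].
  rewrite inE; exists (dsum_in _ (Some b) (a *: e_Re)).
  by rewrite /s dsum_lift_in Re_mapE linearZ.
exists P, (R^o : lmodType R), s; split=> //.
- exact: projective_ring.
- have k1 x : x \in I -> quotpi (im_sub s) x = 0 by move=> Ix; apply/quotpi_eq0; rewrite imI.
  have k2 x : x \in im_sub s -> quotpi I x = 0 by move=> Ix; apply/quotpi_eq0; rewrite -imI.
  exists (quotlift k1); exists (quotlift k2) => x; have [y <-] := quotpi_epi x.
    exact: etrans (congr1 _ (quotliftE k1 y)) (quotliftE k2 y).
  exact: etrans (congr1 _ (quotliftE k2 y)) (quotliftE k1 y).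
move=> X; rewrite (Gen_quot I_two_sided); split=> [DX|TX f].
  apply: ideal_killed => y.
  have [g gE] := DX (dsum_lift (fun o : option R => if o is Some _ then \0 else Re_map y)).
  have := gE (dsum_in _ None e_Re).
  by rewrite /s !dsum_lift_in !Re_mapE scaler0 linear0.
exists \0 => x; rewrite (C_T_hom0 _ TX) //.
by apply: C_class_dsum => _; exact: C_class_Re.
Qed.

End Silting.

(** * Complexes *)

Section Complexes.
Variable R : pzRingType.
Implicit Types (X Y W S V : complex R).

(** Cohomology is treated through cocycles and boundaries inside X k, away from the quotient of a
    subtype that defines it. *)
Definition cyc X k : set (X k) := [set x | cdiff X k (k + 1) x = 0]%classic.
Definition bnd X k : set (X k) := [set x | exists b, x = cdiff X (k - 1) k b]%classic.
Arguments cyc : clear implicits.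
Arguments bnd : clear implicits.

Lemma cycP X k x : (x \in @cocycle R X k) <-> cyc X k x.
Proof. by rewrite inE; split=> /eqP. Qed.

Lemma bnd0 X k : bnd X k 0.
Proof. by exists 0; rewrite linear0. Qed.
Lemma bndD X k x y : bnd X k x -> bnd X k y -> bnd X k (x + y).
Proof. by move=> [b ->] [c ->]; exists (b + c); rewrite linearD. Qed.
Lemma bndZ X k a x : bnd X k x -> bnd X k (a *: x).
Proof. by move=> [b ->]; exists (a *: b); rewrite linearZ. Qed.
Lemma bndN X k x : bnd X k x -> bnd X k (- x).
Proof. by rewrite -scaleN1r; apply: bndZ. Qed.
Lemma bndB X k x y : bnd X k x -> bnd X k y -> bnd X k (x - y).
Proof. by move=> Bx /bndN; apply: bndD. Qed.
Lemma bnd_sum X k n (x : 'I_n -> X k) :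
  (forall i, bnd X k (x i)) -> bnd X k (\sum_(i < n) x i).
Proof. by move=> Bx; elim/big_ind: _ => //; [exact: bnd0|exact: bndD]. Qed.
Lemma cyc0 X k : cyc X k 0.
Proof. exact: linear0. Qed.
Lemma cycD X k x y : cyc X k x -> cyc X k y -> cyc X k (x + y).
Proof. by rewrite /cyc /= linearD => -> ->; rewrite addr0. Qed.
Lemma cycZ X k a x : cyc X k x -> cyc X k (a *: x).
Proof. by rewrite /cyc /= linearZ /= => ->; rewrite scaler0. Qed.
Lemma bnd_cyc X k x : bnd X k x -> cyc X k x.
Proof. by move=> [b ->]; apply: cdiff_sq. Qed.
Lemma cyc_map X Y (f : cmap X Y) k x : cyc X k x -> cyc Y k (f k x).
Proof. by rewrite /cyc /= -cmapP => ->; rewrite linear0. Qed.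
Lemma bnd_map X Y (f : cmap X Y) k x : bnd X k x -> bnd Y k (f k x).
Proof. by move=> [b ->]; exists (f _ b); rewrite cmapP. Qed.

Definition hcl X k (z : submod (@cocycle R X k)) : cohomology X k := quotpi (@coboundary R X k) z.
Definition mkcyc X k x (xP : cyc X k x) : submod (@cocycle R X k) := Sub x ((cycP x).2 xP).

Lemma hcl_congr X k (z w : submod (@cocycle R X k)) : val z = val w -> hcl z = hcl w.
Proof. by move/val_inj ->. Qed.

Lemma hcl_epi X k (y : cohomology X k) : exists x (xP : cyc X k x), y = hcl (mkcyc xP).
Proof.
have [[x xP] <-] := quotpi_epi y; exists x, ((cycP x).1 xP).
exact: hcl_congr.
Qed.

Lemma hcl_eq0 X k (z : submod (@cocycle R X k)) : hcl z = 0 <-> bnd X k (val z).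
Proof. by rewrite quotpi_eq0 inE. Qed.

Lemma hcl_eq X k (z w : submod (@cocycle R X k)) : hcl z = hcl w <-> bnd X k (val z - val w).
Proof. by rewrite quotpi_eq inE. Qed.

Lemma hclZ X k a (z : submod (@cocycle R X k)) : a *: hcl z = hcl (a *: z).
Proof. by rewrite [RHS]linearZ. Qed.

Lemma cohomology_zeroP X k :
  module_zero (cohomology X k) <-> (forall x, cyc X k x -> bnd X k x).
Proof.
split=> [X0 x xP|X0 y]; first exact: (hcl_eq0 (mkcyc xP)).1 (X0 _).
by have [x [xP ->]] := hcl_epi y; apply/hcl_eq0/X0.
Qed.

Lemma cohomology_TP (I : submodClosed R^o) X k : T_class I (cohomology X k) <->
  (forall (a : R) x, (a : R^o) \in I -> cyc X k x -> bnd X k (a *: x)).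
Proof.
split=> [/T_classP TX a x Ia xP|TX].
  by have := TX a (hcl (mkcyc xP)) Ia; rewrite hclZ => /hcl_eq0.
apply/T_classP => a y Ia; have [x [xP ->]] := hcl_epi y.
by rewrite hclZ; apply/hcl_eq0/TX.
Qed.

(** The factors multiplied by I must themselves be cocycles, so that each product is an element of I
    acting on a class. *)
Lemma cohomology_C (I : submodClosed R^o) X k :
  (forall x, cyc X k x -> exists t, ideal_smul I (cyc X k) t /\ bnd X k (x - t)) ->
  C_class I (cohomology X k).
Proof.
move=> CX; apply/C_classP => y; have [x [xP ->]] := hcl_epi y.
have [t [It Bt]] := CX x xP.
have h t' : ideal_smul I (cyc X k) t' ->
    exists tP : cyc X k t', ideal_smul I setT (hcl (mkcyc tP)).
  move: t'; apply: ideal_smul_ind => [|u v [uP Iu] [vP Iv]|a m Ia mP].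
  - exists (@cyc0 X k); rewrite (_ : hcl _ = 0); first exact: ideal_smul0.
    exact/hcl_eq0/bnd0.
  - exists (cycD uP vP); rewrite (_ : hcl _ = hcl (mkcyc uP) + hcl (mkcyc vP)).
      exact: ideal_smulD.
    rewrite -[RHS](linearD (quotpi (@coboundary R X k))); exact: hcl_congr.
  exists (cycZ a mP); rewrite (_ : hcl _ = a *: hcl (mkcyc mP)); first exact: ideal_smul_mem.
  rewrite hclZ; exact: hcl_congr.
have [tP It'] := h t It.
by rewrite (_ : hcl _ = hcl (mkcyc tP)) //; apply/hcl_eq.
Qed.

Lemma cohomology_map_hcl X Y (f : cmap X Y) k x (xP : cyc X k x) :
  cohomology_map f (hcl (mkcyc xP)) = hcl (mkcyc (cyc_map f xP)).
Proof.
apply/hcl_eq => /=.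
have : hcl (repr (hcl (mkcyc xP))) = hcl (mkcyc xP) by rewrite /hcl /= reprK.
by move=> /hcl_eq /= /(bnd_map f); rewrite linearB.
Qed.

Lemma bijective_epi (T U : Type) (f : T -> U) :
  injective f -> (forall y, exists x, f x = y) -> bijective f.
Proof.
move=> fi fs; have /choice[g gP] := fs.
by exists g => // x; apply: fi.
Qed.

Lemma quasi_isoP X Y (f : cmap X Y) : quasi_iso f <->
  forall k, (forall y, cyc Y k y -> exists x, cyc X k x /\ bnd Y k (f k x - y)) /\
            (forall x, cyc X k x -> bnd Y k (f k x) -> bnd X k x).
Proof.
split=> [qf k|qf k].
  have [g gK Kg] := qf k; split=> [y yP|x xP Bx].
    have [x [xP xE]] := hcl_epi (g (hcl (mkcyc yP))).
    exists x; split=> //.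
    by have := Kg (hcl (mkcyc yP)); rewrite xE cohomology_map_hcl => /hcl_eq.
  have: cohomology_map f (hcl (mkcyc xP)) = cohomology_map f (hcl (mkcyc (@cyc0 X k))).
    rewrite !cohomology_map_hcl; apply/hcl_eq => /=.
    by rewrite linear0 subr0.
  by move=> /(can_inj gK)/hcl_eq /=; rewrite subr0.
have [fs fi] := qf k; apply: bijective_epi => [y z|y].
  have [x [xP ->]] := hcl_epi y; have [x' [xP' ->]] := hcl_epi z.
  rewrite !cohomology_map_hcl => /hcl_eq /=; rewrite -linearB => Bx.
  apply/hcl_eq; apply: fi => //=; apply: cycD => //.
  by rewrite -scaleN1r; apply: cycZ.
have [y' [yP ->]] := hcl_epi y; have [x [xP Bx]] := fs y' yP.
by exists (hcl (mkcyc xP)); rewrite cohomology_map_hcl; apply/hcl_eq.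
Qed.

Lemma quasi_iso_comp X Y Z (g : cmap Y Z) (f : cmap X Y) :
  quasi_iso g -> quasi_iso f -> quasi_iso (cmap_comp g f).
Proof.
move=> /quasi_isoP qg /quasi_isoP qf; apply/quasi_isoP => k.
have [gs gi] := qg k; have [fs fi] := qf k; split=> [z zP|x xP Bx].
  have [y [yP By]] := gs z zP; have [x [xP Bx]] := fs y yP.
  exists x; split=> //=; rewrite -[g k _](subrK (g k y)) -linearB -addrA.
  by apply: bndD => //; apply: bnd_map.
by apply: fi => //; apply: gi => //; apply: cyc_map.
Qed.

Lemma quasi_iso_id X (f : cmap X X) : (forall n x, f n x = x) -> quasi_iso f.
Proof.
move=> fE; apply/quasi_isoP => k; split=> [y yP|x xP]; last by rewrite fE.
by exists y; rewrite fE subrr; split=> //; apply: bnd0.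
Qed.

Lemma homotopic_eq X Y (f g : cmap X Y) : (forall n x, f n x = g n x) -> homotopic f g.
Proof.
by move=> fg; exists (fun i j => \0) => n x; rewrite fg subrr /= linear0 addr0.
Qed.

Lemma homotopic_bnd X Y (f g : cmap X Y) k x :
  homotopic f g -> cyc X k x -> bnd Y k (f k x - g k x).
Proof.
by move=> [h hE] xP; rewrite hE (xP : cdiff X k (k + 1) x = 0) linear0 addr0; exists (h k (k - 1) x).
Qed.

Lemma homotopic_sym X Y (f g : cmap X Y) : homotopic f g -> homotopic g f.
Proof.
move=> [h hE]; exists (fun i j => \0 \- h i j) => n x /=.
by rewrite !sub0r linearN -opprD -hE opprB.
Qed.

Lemma homotopic_trans X Y (f g h : cmap X Y) : homotopic f g -> homotopic g h -> homotopic f h.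
Proof.
move=> [s sE] [t tE]; exists (fun i j => s i j \+ t i j) => n x /=.
by rewrite linearD addrACA -sE -tE addrA subrK.
Qed.

Lemma homotopic_compl X Y Z (k : cmap Y Z) (f g : cmap X Y) :
  homotopic f g -> homotopic (cmap_comp k f) (cmap_comp k g).
Proof.
move=> [s sE]; exists (fun i j => k j \o s i j) => n x /=.
by rewrite -linearB sE linearD cmapP.
Qed.

Section SubHomotopy.
Variables (X Y : complex R) (f : cmap X Y) (s : forall i j, {linear X i -> Y j}).
(** f minus the null-homotopic map given by s. It serves to turn components that are null-homotopic
    into components that are zero. *)
Definition sub_htpy_fun n (x : X n) : Y n :=
  f n x - (cdiff Y (n - 1) n (s n (n - 1) x) + s (n + 1) n (cdiff X n (n + 1) x)).
Fact sub_htpy_linear n : linear (@sub_htpy_fun n).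
Proof.
by move=> a x y; rewrite /sub_htpy_fun !linearP addrACA -scalerDr opprD addrACA -scalerBr.
Qed.
Fact sub_htpyP i j x : mklin (@sub_htpy_linear j) (cdiff X i j x) =
  cdiff Y i j (mklin (@sub_htpy_linear i) x).
Proof.
rewrite !mklinE /sub_htpy_fun.
have [->|ij] := eqVneq j (i + 1); last first.
  by rewrite (cdiff_shape (c := X) ij) [RHS](cdiff_shape ij) !linear0 addr0 subr0.
rewrite addrK cdiff_sq linear0 addr0 linearB linearD cdiff_sq add0r.
by rewrite cmapP.
Qed.
Definition sub_htpy : cmap X Y := Cmap sub_htpyP.
Lemma sub_htpyE n x : sub_htpy n x =
  f n x - (cdiff Y (n - 1) n (s n (n - 1) x) + s (n + 1) n (cdiff X n (n + 1) x)).
Proof. by []. Qed.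
End SubHomotopy.

Lemma sign_scale (M : lmodType R) n (x : M) : (-1) ^+ n *: ((-1) ^+ n *: x) = x.
Proof. by rewrite scalerA -signr_odd mulr_sign; case: (odd n); rewrite ?expr1 ?opprK scale1r. Qed.

Lemma shift_diffE X m i j (x : shift X m i) :
  cdiff (shift X m) i j x = (-1) ^+ `|m|%N *: cdiff X (i + m) (j + m) x.
Proof. by []. Qed.

Lemma shift_cyc X m k (x : X (k + m)) : cyc (shift X m) k x <-> cyc X (k + m) x.
Proof.
rewrite /cyc /= /shift_diff addrAC; split=> [xE|->]; last by rewrite scaler0.
by rewrite -[LHS](sign_scale `|m|%N) xE scaler0.
Qed.

Lemma shift_bnd X m k (x : X (k + m)) : bnd (shift X m) k x <-> bnd X (k + m) x.
Proof.
rewrite /bnd /= /shift_diff addrAC; split=> -[b ->]; exists ((-1) ^+ `|m|%N *: b).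
  by rewrite linearZ.
by rewrite linearZ /= sign_scale.
Qed.

(** * Truncated complexes, subcomplexes, quotients and stalks *)

Section Brutal.
Variables (c : pred int) (X : complex R).
(** The terms are submodules of X k, whole or zero, so that no type has to be computed from the
    value of [c k]. *)
Definition brutal_set k : set (X k) := [set x | ~~ c k -> x = 0]%classic.
Fact brutal_set0 k : @brutal_set k 0.
Proof. by []. Qed.
Fact brutal_setD k x y : @brutal_set k x -> @brutal_set k y -> @brutal_set k (x + y).
Proof. by move=> x0 y0 ck; rewrite x0 // y0 // addr0. Qed.
Fact brutal_setZ k a x : @brutal_set k x -> @brutal_set k (a *: x).
Proof. by move=> x0 ck; rewrite x0 // scaler0. Qed.
Definition brutal_sub k : submodClosed (X k) :=
  mksub (@brutal_set0 k) (@brutal_setD k) (@brutal_setZ k).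
Lemma brutal_subP k x : (x \in brutal_sub k) <-> (~~ c k -> x = 0).
Proof. exact: mksubP. Qed.
Lemma brutal_cut_linear k : linear (fun x : X k => if c k then x else 0).
Proof. by move=> a x y; case: ifP; rewrite ?scaler0 ?addr0. Qed.
Lemma brutal_cut_in k x : mklin (@brutal_cut_linear k) x \in brutal_sub k.
Proof. by apply/brutal_subP => ck; rewrite mklinE (negbTE ck). Qed.
Definition brutal_cut k : {linear X k -> submod (brutal_sub k)} := corestr (@brutal_cut_in k).

Lemma brutal_val k (x : submod (brutal_sub k)) : ~~ c k -> val x = 0.
Proof. by move: x => [x xP] ck /=; apply: (brutal_subP x).1. Qed.
Definition brutal_diff i j : {linear submod (brutal_sub i) -> submod (brutal_sub j)} :=
  brutal_cut j \o (cdiff X i j \o subinj (brutal_sub i)).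
Lemma brutal_diffE i j x : val (brutal_diff i j x) = if c j then cdiff X i j (val x) else 0.
Proof. by []. Qed.
Fact brutal_shape i j : j != i + 1 -> forall x, brutal_diff i j x = 0.
Proof. by move=> ij x; apply: val_inj; rewrite brutal_diffE cdiff_shape //; case: ifP. Qed.
Fact brutal_sq i j k x : brutal_diff j k (brutal_diff i j x) = 0.
Proof.
apply: val_inj; rewrite !brutal_diffE; case: ifP => // _.
by case: ifP => _; rewrite ?cdiff_sq ?linear0.
Qed.
Definition brutal : complex R := Complex brutal_shape brutal_sq.
End Brutal.

Section SubComplex.
Variables (X : complex R) (L : forall k, submodClosed (X k)).
Hypothesis dL : forall i x, x \in L i -> cdiff X i (i + 1) x \in L (i + 1).
Lemma subcomplex_closed i j x : x \in L i -> cdiff X i j x \in L j.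
Proof.
move=> Lx; have [->|ij] := eqVneq j (i + 1); first exact: dL.
by rewrite cdiff_shape //; apply: rpred0.
Qed.
Lemma subcomplex_diff_in i j (x : submod (L i)) : (cdiff X i j \o subinj (L i)) x \in L j.
Proof. by apply: subcomplex_closed; case: x. Qed.
Definition subcomplex_diff i j := corestr (@subcomplex_diff_in i j).
Fact subcomplex_shape i j : j != i + 1 -> forall x, subcomplex_diff i j x = 0.
Proof. by move=> ij x; apply: val_inj; apply: cdiff_shape. Qed.
Fact subcomplex_sq i j k x : subcomplex_diff j k (subcomplex_diff i j x) = 0.
Proof. by apply: val_inj; apply: cdiff_sq. Qed.
Definition subcomplex : complex R := Complex subcomplex_shape subcomplex_sq.
Definition subcomplex_inj : cmap subcomplex X :=
  @Cmap R subcomplex X (fun n => subinj (L n)) (fun _ _ _ => erefl).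

Lemma quotcomplex_kill i j x : x \in L i -> (quotpi (L j) \o @cdiff R X i j) x = 0.
Proof. by move=> Lx; apply/quotpi_eq0; apply: subcomplex_closed. Qed.
Definition quotcomplex_diff i j := quotlift (@quotcomplex_kill i j).
Lemma quotcomplex_diffE i j x :
  quotcomplex_diff i j (quotpi (L i) x) = quotpi (L j) (cdiff X i j x).
Proof. exact: quotliftE. Qed.
Fact quotcomplex_shape i j : j != i + 1 -> forall x, quotcomplex_diff i j x = 0.
Proof.
move=> ij y; have [x <-] := quotpi_epi y.
by rewrite quotcomplex_diffE cdiff_shape // linear0.
Qed.
Fact quotcomplex_sq i j k x : quotcomplex_diff j k (quotcomplex_diff i j x) = 0.
Proof.
have [y <-] := quotpi_epi x.
by rewrite !quotcomplex_diffE cdiff_sq linear0.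
Qed.
Definition quotcomplex : complex R := Complex quotcomplex_shape quotcomplex_sq.
Definition quotcomplex_proj : cmap X quotcomplex :=
  @Cmap R X quotcomplex (fun n => quotpi (L n)) (fun i j x => esym (quotcomplex_diffE j x)).
End SubComplex.

Section Stalk.
Variables (M : lmodType R) (m : int).
Definition constant_complex : complex R :=
  @Complex R (fun _ => M) (fun _ _ => \0) (fun _ _ _ _ => erefl) (fun _ _ _ _ => erefl).
Definition stalk : complex R := brutal (pred1 m) constant_complex.
Lemma stalk_diff i j (x : stalk i) : cdiff stalk i j x = 0.
Proof. by apply: val_inj; rewrite [LHS]brutal_diffE; case: ifP. Qed.
Lemma stalk_zero i (x : stalk i) : i != m -> x = 0.
Proof. by move=> im; apply: val_inj; apply: brutal_val. Qed.
Definition stalk_val i : {linear stalk i -> M} := subinj (brutal_sub (pred1 m) constant_complex i).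
Lemma stalk_valK i (x y : stalk i) : stalk_val i x = stalk_val i y -> x = y.
Proof. exact: val_inj. Qed.
Definition stalk_in i : {linear M -> stalk i} := @brutal_cut (pred1 m) constant_complex i.
Lemma stalk_inE i x : stalk_val i (stalk_in i x) = if i == m then x else 0.
Proof. by []. Qed.
End Stalk.

End Complexes.
Arguments cyc {R} X k.
Arguments bnd {R} X k.

(** * Compactness of projective stalk complexes *)

Section ProjectiveSource.
Variables (R : pzRingType) (S : complex R).
Hypotheses (S_diff : forall i j (x : S i), cdiff S i j x = 0)
  (S_proj : forall n, projective (S n)).
Implicit Types (X Y W V : complex R).

Lemma source_cyc n (x : S n) : cyc S n x.
Proof. exact: S_diff. Qed.

Lemma source_bnd n (x : S n) : bnd S n x -> x = 0.
Proof. by move=> [b ->]; apply: S_diff. Qed.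

Section CycMap.
Variables (W : complex R) (t : forall n, {linear S n -> W n}).
Hypothesis t_cyc : forall n x, cyc W n (t n x).
Fact cyc_cmapP i j x : t j (cdiff S i j x) = cdiff W i j (t i x).
Proof.
rewrite S_diff linear0; have [->|ij] := eqVneq j (i + 1); first exact/esym/t_cyc.
by rewrite cdiff_shape.
Qed.
Definition cyc_cmap : cmap S W := Cmap cyc_cmapP.
End CycMap.

(** Boundaries of S are zero, so the cocycles of W map onto S exactly, and projectivity lifts the
    identity through them. *)
Lemma quasi_iso_split W (w : cmap W S) : quasi_iso w ->
  exists t : cmap S W, forall n x, w n (t n x) = x.
Proof.
move=> /quasi_isoP qw.
have tP n : {t : {linear S n -> W n} | forall x, cyc W n (t x) /\ w n (t x) = x}.
  apply: cid; have [ws _] := qw n.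
  pose g := w n \o subinj (@cocycle R W n).
  have ge : epi g.
    move=> y; have [x [xP /source_bnd/eqP]] := ws y (source_cyc y).
    by rewrite subr_eq0 => /eqP xy; exists (mkcyc xP).
  have [h hE] := S_proj idfun ge.
  exists (subinj (@cocycle R W n) \o h) => x; split; last by have := hE x.
  by apply/cycP => /=; case: (h x).
have tc n x : cyc W n (sval (tP n) x) by case: (tP n) => t /= /(_ x)[].
exists (cyc_cmap tc) => n x.
by rewrite /=; case: (tP n) => t /= /(_ x)[].
Qed.

(** As S has zero differential, a homotopy is a lift of f - g through the differential of X,
    supplied by projectivity. *)
Lemma bnd_homotopic X (f g : cmap S X) :
  (forall n x, bnd X n (f n x - g n x)) -> homotopic f g.
Proof.
move=> fg.
have hP i j : {h : {linear S i -> X j} | j = i - 1 -> forall x, cdiff X j i (h x) = f i x - g i x}.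
  apply: cid; have [->|ji] := eqVneq j (i - 1); last by exists \0 => /eqP; rewrite (negbTE ji).
  pose d := cdiff X (i - 1) i.
  have dB x : d x \in im_sub d by rewrite inE; exists x.
  have de : epi (corestr dB).
    move=> [y yB]; have := yB; rewrite inE => -[x xE].
    by exists x; apply: val_inj.
  have fgB x : (f i \- g i) x \in im_sub d.
    by have [b bE] := fg i x; rewrite inE; exists b.
  have [h hE] := S_proj (corestr fgB) de.
  by exists h => _ x; have := congr1 val (hE x).
exists (fun i j => sval (hP i j)) => n x.
rewrite S_diff linear0 addr0.
by case: (hP n (n - 1)) => h /= ->.
Qed.

Lemma roof_split X (a : roof S X) : exists t : cmap S (apex a), forall n x, den a n (t n x) = x.
Proof. exact: quasi_iso_split (den_qis a). Qed.

(** Two cocycles with the same image under a denominator differ by a boundary, so passing to the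
    common refinement and splitting it changes the numerators only by boundaries; [bnd_homotopic]
    then gives the homotopy. *)
Lemma roof_eqP X (a b : roof S X) (ta : cmap S (apex a)) (tb : cmap S (apex b)) :
  (forall n x, den a n (ta n x) = x) -> (forall n x, den b n (tb n x) = x) ->
  roof_eq a b <-> homotopic (cmap_comp (num a) ta) (cmap_comp (num b) tb).
Proof.
move=> taE tbE; split=> [[W [u [v [qu hd hn]]]]|hab]; last first.
  exists S, ta, tb; split=> //; first exact: quasi_iso_id.
  by apply: homotopic_eq => n x /=; rewrite taE tbE.
have [t tE] := quasi_iso_split qu.
have lift_bnd (c : roof S X) n (y z : apex c n) : cyc (apex c) n y -> cyc (apex c) n z ->
    den c n y = den c n z -> bnd X n (num c n y - num c n z).
  move=> yP zP yz; rewrite -linearB; apply: bnd_map.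
  have [_] := (quasi_isoP _).1 (den_qis c) n; apply.
    by apply: cycD => //; rewrite -scaleN1r; apply: cycZ.
  by rewrite linearB yz subrr; apply: bnd0.
have tcyc n x : cyc W n (t n x) by apply: cyc_map; apply: source_cyc.
apply: bnd_homotopic => n x /=.
have h1 : bnd X n (num a n (ta n x) - num a n (u n (t n x))).
  apply: lift_bnd; [| |by rewrite taE; apply/esym/tE].
  - by apply: cyc_map; apply: source_cyc.
  - by apply: cyc_map.
have h2 := homotopic_bnd hn (tcyc n x).
have h3 : bnd X n (num b n (v n (t n x)) - num b n (tb n x)).
  apply: lift_bnd; first by apply: cyc_map.
    by apply: cyc_map; apply: source_cyc.
  have /source_bnd/eqP := homotopic_bnd hd (tcyc n x).
  by rewrite subr_eq0 /= => /eqP <-; rewrite tbE; apply: tE.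
rewrite -[num a n _](subrK (num a n (u n (t n x)))) -addrA; apply: bndD => //.
rewrite -[num a n _](subrK (num b n (v n (t n x)))) -addrA; exact: bndD.
Qed.

Lemma derived_hom_zeroP V :
  derived_hom_zero S V <-> (forall (f : cmap S V) n x, bnd V n (f n x)).
Proof.
split=> [h f n x|h a].
  have hf := (@roof_eqP _ (Roof (@cmap_id_qis R S) f) (roof_zero S V)
    (cmap_id S) (cmap_id S) (fun _ _ => erefl) (fun _ _ => erefl)).1 (h _).
  by have := homotopic_bnd hf (source_cyc x); rewrite /= subr0.
have [t tE] := roof_split a.
apply/(@roof_eqP _ a (roof_zero S V) t (cmap_id S) tE (fun _ _ => erefl)).
apply: bnd_homotopic => n x; rewrite [X in _ - X](_ : _ = 0) // subr0.
exact: h.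
Qed.

Definition csum_proj (J : choiceType) (X : J -> complex R) j : cmap (csum X) (X j) :=
  @Cmap R (csum X) (X j) (fun n => dsum_proj (fun j => X j n) j) (fun _ _ _ => erefl).

(** A map into the sum is determined by the images of finitely many generators, each of finite
    support. Uniqueness follows by projecting homotopic numerators to one summand. *)
Lemma fg_source_compact (n0 : int) : (forall n (x : S n), n != n0 -> x = 0) ->
  finitely_generated (S n0) -> compact S.
Proof.
move=> S0 [m [s sP]] J X; split=> [psi|phi phi' psi].
  have [t tE] := roof_split psi.
  pose g := cmap_comp (num psi) t.
  pose f j := cmap_comp (csum_proj X j) g.
  exists (fun j => Roof (@cmap_id_qis R S) (f j)).
  exists S, (cmap_id S), (@cmap_id_qis R S), f, g; split=> //.
  - apply: (@sub_finite_set _ _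
      (\bigcup_(i in [set: 'I_m]) [set j | val (g n0 (s i)) j <> 0])%classic).
      move=> j nz; apply: contrapT => nj; apply: nz => n w.
      have [En|nn0] := eqVneq n n0; last by rewrite (S0 n w nn0); apply: (linear0 (f j n)).
      subst n; have [a ->] := sP w.
      rewrite (linear_sum (f j n0)) big1 // => i _; rewrite (linearZZ (f j n0)).
      suff -> : f j n0 (s i) = 0 by apply: scaler0.
      by apply: contrapT => fnz; apply: nj; exists i.
    apply: bigcup_finite => [|i _]; first exact: finite_finset.
    exact: dsum_fin.
  - move=> j; apply/(@roof_eqP _ (Roof (@cmap_id_qis R S) (f j))
      (Roof (@cmap_id_qis R S) (f j)) (cmap_id S) (cmap_id S)) => //.
    exact: homotopic_eq.
  - apply/(@roof_eqP _ psi (Roof (@cmap_id_qis R S) g) t (cmap_id S) tE) => //.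
    exact: homotopic_eq.
move=> [W [s1 [q1 [f1 [g1 [_ gf1 h1 p1]]]]]] [W' [s2 [q2 [f2 [g2 [_ gf2 h2 p2]]]]]] j.
have [t1 t1E] := quasi_iso_split q1; have [t2 t2E] := quasi_iso_split q2.
have [tp tpE] := roof_split psi.
have [a aE] := roof_split (phi j); have [a' a'E] := roof_split (phi' j).
have {p1}p1 := (@roof_eqP _ psi (Roof q1 g1) tp t1 tpE t1E).1 p1.
have {p2}p2 := (@roof_eqP _ psi (Roof q2 g2) tp t2 tpE t2E).1 p2.
have {h1}h1 := (@roof_eqP _ (phi j) (Roof q1 (f1 j)) a t1 aE t1E).1 (h1 j).
have {h2}h2 := (@roof_eqP _ (phi' j) (Roof q2 (f2 j)) a' t2 a'E t2E).1 (h2 j).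
apply/(roof_eqP aE a'E); apply: homotopic_trans h1 _.
apply: homotopic_trans (homotopic_sym h2).
have := homotopic_compl (csum_proj X j) (homotopic_trans (homotopic_sym p1) p2).
move=> hp; apply: homotopic_trans (homotopic_trans _ hp) _; apply: homotopic_eq => n x.
  exact/esym/gf1.
exact: gf2.
Qed.

End ProjectiveSource.

Section ShiftedStalk.
Variables (R : pzRingType) (P : lmodType R) (m : int).
Hypothesis P_proj : projective P.

Lemma projective_stalk i : projective (stalk P m i).
Proof.
apply: (@projective_retract _ _ _ (stalk_val P m i) (stalk_in P m i)) => // x.
apply: stalk_valK; rewrite stalk_inE; case: eqVneq => // im.
by rewrite (stalk_zero x im) linear0.
Qed.

Lemma compact_stalk : finitely_generated P -> compact (stalk P m).
Proof.
move=> [n [g gP]]; apply: (@fg_source_compact _ (stalk P m) _ _ m).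
- by move=> i j x; apply: stalk_diff.
- exact: projective_stalk.
- by move=> i x; apply: stalk_zero.
exists n, (fun i => stalk_in P m m (g i)) => x.
have [a xE] := gP (stalk_val P m m x); exists a; apply: stalk_valK.
rewrite linear_sum xE; apply: eq_bigr => i _.
by rewrite linearZZ stalk_inE eqxx.
Qed.

(** For projective P, morphisms from the shifted stalk to V amount to maps from P to H^(m-k)(V). *)
Lemma shifted_stalk_hom (k : nat) V : derived_hom_zero (shift (stalk P m) k%:Z) V <->
  (forall f : {linear P -> V (m - k%:Z)},
     (forall x, cyc V _ (f x)) -> forall x, bnd V _ (f x)).
Proof.
have S_diff i j x : cdiff (shift (stalk P m) k%:Z) i j x = 0.
  by rewrite shift_diffE stalk_diff scaler0.
have S_proj n : projective (shift (stalk P m) k%:Z n) by apply: projective_stalk.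
split=> [/derived_hom_zeroP h f fc x|h].
  have E : m - k%:Z + k%:Z = m by rewrite subrK.
  pose n0 := m - k%:Z.
  pose f0 : {linear shift (stalk P m) k%:Z n0 -> V n0} := f \o stalk_val P m (n0 + k%:Z).
  pose t := dfwith (fun n => \0 : {linear shift (stalk P m) k%:Z n -> V n}) f0.
  have tn0 : t n0 = f0 by apply: dfwith_in.
  have tc n y : cyc V n (t n y).
    have [En|nn0] := eqVneq n0 n; last by rewrite /t dfwith_out //; apply: cyc0.
    by subst n; rewrite tn0; apply: fc.
  have xE : stalk_val P m (n0 + k%:Z) (stalk_in P m (n0 + k%:Z) x) = x.
    by rewrite stalk_inE E eqxx.
  have := h S_diff S_proj (cyc_cmap S_diff tc) n0 (stalk_in P m (n0 + k%:Z) x).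
  rewrite [cyc_cmap _ _ _ _](_ : _ = f x) //.
  by rewrite -[in RHS]xE; change (t n0 (stalk_in P m (n0 + k%:Z) x) = f0 (stalk_in P m (n0 + k%:Z) x)); rewrite tn0.
apply/derived_hom_zeroP => // f n x.
have [En|nn0] := eqVneq (n + k%:Z) m; last first.
  by rewrite (_ : x = 0) ?linear0; [apply: bnd0 | apply: (stalk_zero (M := P) (m := m))].
have En' : m - k%:Z = n by rewrite -En addrK.
rewrite En' in h.
have <- : f n (stalk_in P m (n + k%:Z) (stalk_val P m (n + k%:Z) x)) = f n x.
  congr (f n _); apply: (stalk_valK (M := P) (m := m)).
  by rewrite stalk_inE ifT // En eqxx.
apply: (h (f n \o stalk_in P m (n + k%:Z))) => y.
by apply: cyc_map; apply: S_diff.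
Qed.

End ShiftedStalk.

(** * From I = ReR to a compactly generated t-structure *)

Section FullToTCG.
Variables (R : pzRingType) (I : submodClosed R^o).
Hypotheses (I_two_sided : two_sided I) (I_idempotent : idempotent_ideal I).
Variable e : R.
Hypothesis full_e : full_idempotent I e.

Lemma fg_ring : finitely_generated (R^o : lmodType R).
Proof.
exists 1%N, (fun=> 1) => x; exists (fun=> x).
by rewrite big_ord1 /GRing.scale /= mulr1.
Qed.

(** The shifts R[1 + k] detect H^(-1-k)(V), and Re in degree 0 detects e H^0(V), which vanishes
    exactly when I kills H^0(V). *)
Lemma tCG_of_full : tCG (C_class I) (T_class I).
Proof.
split; first exact: C_T_torsion_pair.
exists bool, (fun b => if b then stalk (submod (Re e)) 0 else stalk (R^o : lmodType R) (-1)).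
split=> [[]|V].
- apply: compact_stalk; first exact: projective_Re full_e.
  exact: fg_Re full_e.
- apply: compact_stalk; first exact: projective_ring.
  exact: fg_ring.
have PRe := projective_Re full_e; have PR := @projective_ring R.
split=> [[V0 /cohomology_TP VT] [] k|h].
- apply/shifted_stalk_hom => // f fc x.
  case: k f fc x => [|k] f fc x; last first.
    by apply: ((cohomology_zeroP _ _).1 (V0 _ _)).
  have := fc x; have := @C_class_Re R I e full_e.
  move: f fc; rewrite subr0 => f fc /C_classP CRe _.
  have [n [a [z [Ia _ ->]]]] := CRe x.
  rewrite linear_sum; apply: bnd_sum => i; rewrite linearZ /=; exact: VT.
- apply/shifted_stalk_hom => // f fc x.
  by apply: ((cohomology_zeroP _ _).1 (V0 _ _)) => //; lia.
have hR k := (shifted_stalk_hom (-1) PR k V).1 (h false k).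
have hRe := (shifted_stalk_hom 0 PRe 0 V).1 (h true 0).
split=> [k k0|].
  apply/cohomology_zeroP => x xP.
  have [m Em] : exists m : nat, k = -1 - m%:Z.
    by exists (`|k|.-1)%N; lia.
  subst k; have := hR m (mkrow x) _ 1; rewrite mkrowE scale1r; apply=> r.
  by rewrite mkrowE; apply: cycZ.
rewrite subr0 in hRe.
apply/cohomology_TP => a x Ia xP.
have [_ _ /(_ _ Ia)/ReRP] := full_e; move: a {Ia}.
apply: addspan_ind => [|a b Ba Bb|_ [a [b ->]]].
- by rewrite scale0r; apply: bnd0.
- by rewrite scalerDl; apply: bndD.
rewrite -2!scalerA; apply: bndZ.
have := hRe (@Re_map _ e (V 0) (b *: x)) _ (e_Re full_e); apply=> y.
by rewrite Re_mapE; apply: cycZ; apply: cycZ.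
Qed.

End FullToTCG.

(** * The Happel-Reiten-Smalo aisle *)

Section Aisle.
Variable R : pzRingType.
Implicit Types (S V W X : complex R) (I : submodClosed R^o).

(** A cocycle of S lifts, up to a boundary, to the common refinement, where f becomes homotopic to
    zero. *)
Lemma derived_hom_zero_bnd S V (f : cmap S V) k x :
  derived_hom_zero S V -> cyc S k x -> bnd V k (f k x).
Proof.
move=> /(_ (Roof (@cmap_id_qis R S) f))[W [u [v [/quasi_isoP qu _ h]]]] xP.
have [us _] := qu k; have [z [zP /= Bz]] := us x xP.
have := homotopic_bnd h zP; rewrite /= subr0 => Bf.
rewrite -[f k x](subKr (f k (u k z))) -linearB; apply: bndB => //.
exact: bnd_map.
Qed.

Section Truncation.
Variables (I : submodClosed R^o) (S : complex R).

(** The subcomplex to divide out: everything in negative degrees, IZ^0 + B^0 in degree 0, nothing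
    above. The quotient has cohomology H^0(S)/I H^0(S) in degree 0 and H^k(S) for k > 0. *)
Definition perp_set k : set (S k) := [set x | ~~ (k < 0)%R ->
  if k == 0 then exists t, ideal_smul I (cyc S k) t /\ bnd S k (x - t) else x = 0]%classic.
Fact perp_set0 k : @perp_set k 0.
Proof.
move=> _; case: eqP => // _; exists 0; split; first exact: ideal_smul0.
by rewrite subrr; apply: bnd0.
Qed.
Fact perp_setD k x y : @perp_set k x -> @perp_set k y -> @perp_set k (x + y).
Proof.
move=> xP yP k0; move: (xP k0) (yP k0); case: eqP => _; last by move=> -> ->; rewrite addr0.
move=> [t [It Bt]] [t' [It' Bt']]; exists (t + t'); split; first exact: ideal_smulD.
by rewrite opprD addrACA; apply: bndD.
Qed.
Fact perp_setZ k a x : @perp_set k x -> @perp_set k (a *: x).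
Proof.
move=> xP k0; move: (xP k0); case: eqP => _; last by move=> ->; rewrite scaler0.
move=> [t [It Bt]]; exists (a *: t); split; first exact: ideal_smulZ.
by rewrite -scalerBr; apply: bndZ.
Qed.
Definition perp_sub k : submodClosed (S k) :=
  mksub (@perp_set0 k) (@perp_setD k) (@perp_setZ k).
Lemma perp_subP k x : x \in perp_sub k <-> @perp_set k x.
Proof. exact: mksubP. Qed.

Lemma ideal_cyc k t : ideal_smul I (cyc S k) t -> cyc S k t.
Proof.
move: t; apply: ideal_smul_ind => [|x y|a m _]; [exact: cyc0|exact: cycD|exact: cycZ].
Qed.

Fact perp_sub_diff i x : x \in perp_sub i -> cdiff S i (i + 1) x \in perp_sub (i + 1).
Proof.
move=> /perp_subP xP; apply/perp_subP => i1.
have [i10|i10] := eqVneq (i + 1) 0.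
  exists 0; split; first exact: ideal_smul0.
  by rewrite subr0 /bnd /= addrK; exists x.
have i0 : ~~ (i < 0)%R by lia.
move: (xP i0); case: eqP => [_|_ ->]; last exact: linear0.
move=> [t [/ideal_cyc tP /bnd_cyc Bt]].
have := cycD Bt tP; by rewrite subrK.
Qed.

(* Kills everything below degree 0, and I H^0(S). *)
Definition perp_trunc : complex R := quotcomplex perp_sub_diff.

Lemma perp_trunc_orthogonal :
  (forall k, (k < 0)%R -> module_zero (cohomology perp_trunc k)) /\
  T_class I (cohomology perp_trunc 0).
Proof.
split=> [k k0|].
  apply/cohomology_zeroP => y _; suff -> : y = 0 by apply: bnd0.
  by have [x <-] := quotpi_epi y; apply/quotpi_eq0/perp_subP; rewrite /perp_set /= k0.
apply/cohomology_TP => a y Ia; have [x <-] := quotpi_epi y.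
move=> yP; have : quotpi (perp_sub (0 + 1)) (cdiff S 0 (0 + 1) x) = 0.
  by rewrite -(quotcomplex_diffE perp_sub_diff).
move=> /quotpi_eq0/perp_subP xP.
suff -> : a *: quotpi (perp_sub 0) x = 0 by apply: bnd0.
rewrite -linearZ; apply/quotpi_eq0/perp_subP => _ /=.
exists (a *: x); split; last by rewrite subrr; apply: bnd0.
by apply: ideal_smul_mem => //; apply: xP.
Qed.

Lemma perp_trunc_cyc k x : ~~ (k < 0)%R -> cyc S k x ->
  bnd perp_trunc k (quotpi (perp_sub k) x) ->
  if k == 0 then exists t, ideal_smul I (cyc S k) t /\ bnd S k (x - t) else bnd S k x.
Proof.
move=> k0 xP [b]; have [b' <-] := quotpi_epi b.
move=> bE; have := etrans bE (quotcomplex_diffE perp_sub_diff k b').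
move=> /quotpi_eq/perp_subP/(_ k0); case: eqP => _.
  move=> [t [It Bt]]; exists t; split=> //.
  rewrite -[x](subrK (cdiff S (k - 1) k b')) addrAC; apply: bndD => //.
  by exists b'.
by move=> /eqP; rewrite subr_eq0 => /eqP ->; exists b'.
Qed.

End Truncation.

(** The projection to the truncation is zero in D(R), hence on cohomology. The shift by 0 is the k =
    0 instance of the generation condition; its terms S (k + 0) are not literally those of S. *)
Lemma aisle_cohomology I S :
  derived_hom_zero (shift S 0) (perp_trunc I (shift S 0)) ->
  (forall k x, (0 < k)%R -> cyc S k x -> bnd S k x) /\
  (forall x, cyc S 0 x -> exists t, ideal_smul I (cyc S 0) t /\ bnd S 0 (x - t)).
Proof.
move=> h; pose pr := quotcomplex_proj (@perp_sub_diff I (shift S 0)).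
have main k x : ~~ (k < 0)%R -> cyc (shift S 0) k x ->
  if k == 0 then exists t, ideal_smul I (cyc (shift S 0) k) t /\ bnd (shift S 0) k (x - t)
  else bnd (shift S 0) k x.
  move=> k0 xP; apply: perp_trunc_cyc => //.
  exact: (derived_hom_zero_bnd pr h xP).
split=> [k|x xP].
  rewrite -[k]addr0 => x k0 xP; rewrite addr0 in k0.
  have := main k x _ ((shift_cyc x).2 xP); case: eqP => [|_ h']; first by lia.
  by apply/(@shift_bnd R S 0 k x)/h'; lia.
have [|t [It Bt]] := main 0 x isT; first exact/(@shift_cyc R S 0 0 x).
exists t; split; last exact/(@shift_bnd R S 0 0 (x - t)).
move: t It {Bt}; apply: ideal_smul_ind => [|t t'|a m Ia mP]; [exact: ideal_smul0|exact: ideal_smulD|].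
by apply: ideal_smul_mem => //; apply/(@shift_cyc R S 0 0 m).
Qed.

Section SmartTruncation.
Variable W : complex R.
(** The truncation of W in degrees at most 0, with degree 0 term Z^0(W). *)
Definition smart_set k : set (W k) := [set x | ~~ (k < 0)%R ->
  if k == 0 then cyc W k x else x = 0]%classic.
Fact smart_set0 k : @smart_set k 0.
Proof. by move=> _; case: eqP => // _; apply: cyc0. Qed.
Fact smart_setD k x y : @smart_set k x -> @smart_set k y -> @smart_set k (x + y).
Proof.
move=> xP yP k0; move: (xP k0) (yP k0); case: eqP => _; first exact: cycD.
by move=> -> ->; rewrite addr0.
Qed.
Fact smart_setZ k a x : @smart_set k x -> @smart_set k (a *: x).
Proof.
move=> xP k0; move: (xP k0); case: eqP => _; first exact: cycZ.
by move=> ->; rewrite scaler0.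
Qed.
Definition smart_sub k : submodClosed (W k) :=
  mksub (@smart_set0 k) (@smart_setD k) (@smart_setZ k).
Lemma smart_subP k x : x \in smart_sub k <-> @smart_set k x.
Proof. exact: mksubP. Qed.
Fact smart_sub_diff i x : x \in smart_sub i -> cdiff W i (i + 1) x \in smart_sub (i + 1).
Proof.
move=> /smart_subP xP; apply/smart_subP => i1.
case: eqP => [i10|i10]; first exact: cdiff_sq.
have i0 : ~~ (i < 0)%R by lia.
by move: (xP i0); case: eqP => // _ ->; apply: linear0.
Qed.
Definition smart_trunc : complex R := subcomplex smart_sub_diff.
Definition smart_inj : cmap smart_trunc W := subcomplex_inj smart_sub_diff.

Lemma smart_inj_cyc (x : smart_trunc 0) : cyc W 0 (smart_inj 0 x).
Proof. by case: x => x /= /smart_subP/(_ isT). Qed.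

Lemma smart_inj_qis : (forall k x, (0 < k)%R -> cyc W k x -> bnd W k x) -> quasi_iso smart_inj.
Proof.
move=> W0; apply/quasi_isoP => k; split=> [y yP|x xP].
  have [k0|k0] : (0 < k)%R \/ (k <= 0)%R by lia.
    exists 0; split; first exact: cyc0.
    by rewrite linear0 sub0r; apply/bndN/W0.
  have yL : y \in smart_sub k.
    by apply/smart_subP => k1; have -> : k == 0 by lia.
  exists (Sub y yL : submod (smart_sub k)); split; first exact: val_inj.
  by rewrite /= subrr; apply: bnd0.
move=> [b bE]; have [k0|k0] : (0 < k)%R \/ (k <= 0)%R by lia.
  suff -> : x = 0 by apply: bnd0.
  apply: val_inj; case: x {xP bE} => x /= /smart_subP xP.
  have k1 : ~~ (k < 0)%R by lia.
  by have := xP k1; case: eqP => //; lia.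
have bL : b \in smart_sub (k - 1) by apply/smart_subP => k1; lia.
by exists (Sub b bL : submod (smart_sub (k - 1))); apply: val_inj.
Qed.
End SmartTruncation.

Definition fg_cyc X k : Prop := exists n (s : 'I_n -> X k), (forall i, cyc X k (s i)) /\
  forall x, cyc X k x -> exists a : 'I_n -> R, bnd X k (x - \sum_(i < n) a i *: s i).

Lemma fg_cyc_qis W S (w : cmap W S) k : quasi_iso w -> fg_cyc S k -> fg_cyc W k.
Proof.
move=> /quasi_isoP/(_ k)[ws wi] [n [s [sP sgen]]].
have /choice[z zP] i := ws (s i) (sP i).
exists n, z; split=> [i|x xP]; first by case: (zP i).
have [a Ba] := sgen (w k x) (cyc_map w xP); exists a.
have zc : cyc W k (\sum_(i < n) a i *: z i).
  by elim/big_ind: _ => [||i _]; [exact: cyc0|exact: cycD|apply: cycZ; case: (zP i)].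
apply: wi; first by apply: cycD => //; rewrite -scaleN1r; apply: cycZ.
rewrite linearB -[w k x](subrK (\sum_(i < n) a i *: s i)) -addrA; apply: bndD => //.
rewrite linear_sum -sumrB; apply: bnd_sum => i.
rewrite linearZ -scalerBr -[_ - _]opprB; apply/bndZ/bndN.
by case: (zP i).
Qed.

(** The combination is lifted term by term, each cocycle of S being, up to a boundary, the image of
    a cocycle of W. *)
Lemma C_cyc_qis I W S (w : cmap W S) k : quasi_iso w ->
  (forall x, cyc S k x -> exists t, ideal_smul I (cyc S k) t /\ bnd S k (x - t)) ->
  (forall x, cyc W k x -> exists t, ideal_smul I (cyc W k) t /\ bnd W k (x - t)).
Proof.
move=> /quasi_isoP/(_ k)[ws wi] SC x xP.
have [t [It Bt]] := SC _ (cyc_map w xP).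
have [t' [It' Bt']] : exists t', ideal_smul I (cyc W k) t' /\ bnd S k (w k t' - t).
  move: t It {Bt}; apply: ideal_smul_ind => [|t1 t2 [u1 [I1 B1]] [u2 [I2 B2]]|a m Ia mP].
  - exists 0; rewrite linear0 subrr; split; [exact: ideal_smul0|exact: bnd0].
  - exists (u1 + u2); split; first exact: ideal_smulD.
    by rewrite linearD opprD addrACA; apply: bndD.
  have [z [zP Bz]] := ws m mP; exists (a *: z); split; first exact: ideal_smul_mem.
  by rewrite linearZ -scalerBr; apply: bndZ.
exists t'; split=> //; apply: wi.
  by apply: cycD => //; rewrite -scaleN1r; apply/cycZ/(ideal_cyc It').
rewrite linearB -[w k x](subrK t) -addrA; apply: bndD => //.
by rewrite -opprB; apply: bndN.
Qed.

Lemma fg_cohomology X k : fg_cyc X k -> finitely_generated (cohomology X k).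
Proof.
move=> [n [s [sP sgen]]]; exists n, (fun i => hcl (mkcyc (sP i))) => y.
have [x [xP ->]] := hcl_epi y; have [a Ba] := sgen x xP; exists a.
have -> : \sum_(i < n) a i *: hcl (mkcyc (sP i)) = hcl (\sum_(i < n) a i *: mkcyc (sP i)).
  by rewrite [RHS]linear_sum; apply: eq_bigr => i _; rewrite hclZ.
by apply/hcl_eq; rewrite (linear_sum (subinj (@cocycle R X k))).
Qed.

(** The degree 0 part of a numerator induces a map from H^0 of the apex to Y. For k > 0 this H^0
    vanishes; for k = 0 it is finitely generated and equal to I times itself, so Nakayama
    applies. *)
Lemma derived_hom_killed I (e : R) S (Y : lmodType R) (k : nat) :
  two_sided I -> (forall x : R, (x : R^o) \in I -> jac (x * (1 - e))) ->
  (forall y : Y, e *: y = 0) ->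
  (forall k x, (0 < k)%R -> cyc S k x -> bnd S k x) ->
  (forall x, cyc S 0 x -> exists t, ideal_smul I (cyc S 0) t /\ bnd S 0 (x - t)) ->
  fg_cyc S 0 -> derived_hom_zero (shift S k%:Z) (stalk Y 0).
Proof.
move=> Its e_jac eY S0 SC Sfg a.
have qd := den_qis a; have /quasi_isoP di := qd.
have W0 i x : (0 < i + k%:Z)%R -> cyc (apex a) i x -> bnd (apex a) i x.
  move=> ik xP; apply: (di i).2 => //.
  by apply/shift_bnd; apply: S0 => //; apply/shift_cyc; apply: cyc_map.
pose f := stalk_val Y 0 0 \o num a 0.
have fB x : bnd (apex a) 0 x -> f x = 0.
  move=> [b ->]; change (stalk_val Y 0 0 (num a 0 (cdiff _ (0 - 1) 0 b)) = 0).
  by rewrite cmapP stalk_diff linear0.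
have f0 z : cyc (apex a) 0 z -> f z = 0.
  move=> zP; have [k0|k0] := eqVneq k 0%N; last by apply/fB/W0 => //; lia.
  subst k.
  have fgW : finitely_generated (cohomology (apex a) 0).
    apply/fg_cohomology/(fg_cyc_qis qd).
    have [n [s [sP sg]]] := Sfg; exists n, s; split=> [i|x /shift_cyc xP].
      exact/shift_cyc.
    by have [c Bc] := sg x xP; exists c; apply/shift_bnd.
  have CW : C_class I (cohomology (apex a) 0).
    apply/cohomology_C/(C_cyc_qis qd) => x /shift_cyc xP.
    have [t [It Bt]] := SC x xP; exists t; split; last exact/shift_bnd.
    move: t It {Bt}; apply: ideal_smul_ind => [|t t'|c m Ic mP]; [exact: ideal_smul0|exact: ideal_smulD|].
    by apply: ideal_smul_mem => //; apply/shift_cyc.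
  have kill (y : submod (@cocycle R (apex a) 0)) : y \in @coboundary R (apex a) 0 ->
      (f \o subinj (@cocycle R (apex a) 0)) y = 0.
    by rewrite inE => By; apply: fB.
  have := killed_fg Its e_jac fgW CW eY (quotlift kill) (hcl (mkcyc zP)).
  by rewrite [LHS]quotliftE.
(* On the smart truncation the degree 0 term consists of cocycles, so the numerator is zero there
   and no homotopy is required. *)
exists (smart_trunc (apex a)), (smart_inj (apex a)), (cmap_comp (den a) (smart_inj (apex a))).
have qs : quasi_iso (smart_inj (apex a)).
  by apply: smart_inj_qis => i x i0; apply: W0; lia.
split; [exact: quasi_iso_comp|exact: homotopic_eq|].
apply: homotopic_eq => n x.
have [n0|n0] := eqVneq n 0; last by rewrite [LHS](stalk_zero _ n0).
subst n; apply: stalk_valK; rewrite [RHS]linear0.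
exact: (f0 _ (smart_inj_cyc x)).
Qed.

End Aisle.

(** * Compact objects have finitely generated top cohomology *)

Section Resolution.
Variables (R : pzRingType) (S : complex R).

(** The degree -n, in constructor form so that types indexed by it reduce. *)
Definition level (n : nat) : int := if n is m.+1 then Negz m else 0.

Lemma level_succ n : Negz n + 1 = level n.
Proof. by case: n => [|n] /=; lia. Qed.

(** Only the data from which the next term is built. The target is an arbitrary module, so the
    recursion keeps no record of earlier bases. *)
Record stage (n : nat) := Stage {
  st_basis : choiceType;
  st_target : lmodType R;
  st_diff : {linear free R st_basis -> st_target};
  st_aug : {linear free R st_basis -> S (level n)} }.

Definition next_pred n (s : stage n) : pred (free R (st_basis s) * S (level n.+1)) :=
  [pred q | `[< st_diff s q.1 = 0 /\ st_aug s q.1 = cdiff S (level n.+1) (level n) q.2 >]].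
Arguments next_pred {n} s.

(* The free module on the pairs (z, y) with dz = 0 and f z = dy: it makes the
   augmentation surjective on cocycles and kills the surplus cohomology. *)
Definition next_stage n (s : stage n) : stage n.+1 :=
  @Stage n.+1 {q | next_pred s q} (free R (st_basis s))
    (flift (fun q : {q | next_pred s q} => (val q).1))
    (flift (fun q : {q | next_pred s q} => (val q).2)).

(** The zero map to R is a placeholder: it makes the condition dz = 0 void in degree 0. *)
Definition first_stage : stage 0 :=
  @Stage 0 (submod (@cocycle R S 0)) (R^o : lmodType R) \0 (flift val).

Fixpoint stages n : stage n :=
  if n is m.+1 then next_stage (stages m) else first_stage.

Lemma next_sq n x : st_diff (stages n) (st_diff (stages n.+1) x) = 0.
Proof.
apply: (free_eq_lin (f := st_diff (stages n) \o st_diff (stages n.+1)) (g := \0)) => -[q qP].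
change (st_diff (stages n) (st_diff (stages n.+1) (fbase R (exist _ q qP))) = 0).
by rewrite [st_diff (stages n.+1) _]flift_base; have /asboolP[] := qP.
Qed.

Lemma next_aug n x : st_aug (stages n) (st_diff (stages n.+1) x) =
  cdiff S (level n.+1) (level n) (st_aug (stages n.+1) x).
Proof.
apply: (free_eq_lin (f := st_aug (stages n) \o st_diff (stages n.+1))
  (g := cdiff S (level n.+1) (level n) \o st_aug (stages n.+1))) => -[q qP].
change (st_aug (stages n) (st_diff (stages n.+1) (fbase R (exist _ q qP))) =
  cdiff S (level n.+1) (level n) (st_aug (stages n.+1) (fbase R (exist _ q qP)))).
rewrite [st_diff (stages n.+1) _]flift_base [st_aug (stages n.+1) _]flift_base.
by have /asboolP[] := qP.
Qed.

Lemma next_exact n z y : st_diff (stages n) z = 0 ->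
  st_aug (stages n) z = cdiff S (level n.+1) (level n) y ->
  exists x, st_diff (stages n.+1) x = z /\ st_aug (stages n.+1) x = y.
Proof.
move=> dz fz; have qP : next_pred (stages n) (z, y) by apply/asboolP.
exists (fbase R (exist _ (z, y) qP)).
by rewrite [st_diff (stages n.+1) _]flift_base [st_aug (stages n.+1) _]flift_base.
Qed.

Definition res_basis (i : int) : choiceType :=
  match i with
  | Posz 0 => st_basis (stages 0)
  | Posz _ => void
  | Negz n => st_basis (stages n.+1)
  end.

Definition res_aug i : {linear free R (res_basis i) -> S i} :=
  match i with
  | Posz 0 => st_aug (stages 0)
  | Posz _ => \0
  | Negz n => st_aug (stages n.+1)
  end.

(** Both branches are [st_diff (stages n.+1)]; the match lets [res_basis (level n)] reduce. *)
Definition res_step n : {linear free R (res_basis (Negz n)) -> free R (res_basis (level n))} :=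
  match n with
  | 0 => st_diff (stages 1)
  | m.+1 => st_diff (stages m.+2)
  end.

Definition res_diff i j : {linear free R (res_basis i) -> free R (res_basis j)} :=
  match i with
  | Posz _ => \0
  | Negz n => dfwith (fun j => \0 : {linear free R (res_basis (Negz n)) -> free R (res_basis j)})
                (res_step n) j
  end.

Lemma res_diff_in n x : res_diff (Negz n) (level n) x = res_step n x.
Proof. by rewrite /res_diff dfwith_in. Qed.

Lemma res_diff_out n j x : j != level n -> res_diff (Negz n) j x = 0.
Proof. by move=> nj; rewrite /res_diff dfwith_out // eq_sym. Qed.

Fact res_shape i j : j != i + 1 -> forall x, res_diff i j x = 0.
Proof.
case: i => // n; rewrite level_succ => nj x; exact: res_diff_out.
Qed.

Lemma res_step_sq n x : res_step n (res_step n.+1 x) = 0.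
Proof. by case: n x => [|n] x; [apply: (@next_sq 1) | apply: (@next_sq n.+2)]. Qed.

Fact res_sq i j k x : res_diff j k (res_diff i j x) = 0.
Proof.
case: i x => [n|n] x; first exact: linear0.
have [->|nj] := eqVneq j (level n); last by rewrite res_diff_out // linear0.
rewrite res_diff_in; case: n x => [//|n] x.
have [->|nk] := eqVneq k (level n); last exact: res_diff_out.
by rewrite [LHS]res_diff_in res_step_sq.
Qed.

Definition resolution : complex R := Complex res_shape res_sq.

Lemma res_pos k (x : resolution k) : (0 < k)%R -> x = 0.
Proof. by case: k x => [[|k]|k] x // _; apply: dsumP => -[]. Qed.

Lemma res_aug_step n x : res_aug (level n) (res_step n x) =
  cdiff S (Negz n) (level n) (res_aug (Negz n) x).
Proof. by case: n x => [|n] x; [apply: (@next_aug 0) | apply: (@next_aug n.+1)]. Qed.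

Lemma res_aug_cyc x : cyc S 0 (res_aug 0 x).
Proof.
move: x; apply: dsum_ind => [|x y|a r].
- by rewrite linear0; apply: cyc0.
- by rewrite linearD; apply: cycD.
rewrite fbaseZ linearZ; apply: cycZ; rewrite [res_aug 0 _]flift_base.
by apply/cycP; case: a.
Qed.

Fact res_augP i j x : res_aug j (res_diff i j x) = cdiff S i j (res_aug i x).
Proof.
case: i x => [[|n]|n] x.
- rewrite linear0; have [->|j1] := eqVneq j (0 + 1); first exact/esym/res_aug_cyc.
  by rewrite cdiff_shape.
- by rewrite !linear0.
have [->|nj] := eqVneq j (level n); first by rewrite res_diff_in res_aug_step.
by rewrite res_diff_out // linear0 cdiff_shape // level_succ.
Qed.
Definition res_map : cmap resolution S := @Cmap R resolution S res_aug res_augP.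

Lemma res_exact n (z : resolution (Negz n)) y :
  res_step n z = 0 -> res_aug (Negz n) z = cdiff S (Negz n.+1) (Negz n) y ->
  exists x, res_step n.+1 x = z /\ res_aug (Negz n.+1) x = y.
Proof. by case: n z y => [|n] z y; [apply: (@next_exact 1) | apply: (@next_exact n.+2)]. Qed.

(** In negative degrees a cocycle y is hit through the pair (0, y). In degrees at most 0 a cocycle z
    with image dy is the boundary of the basis vector (z, y). *)
Lemma res_map_qis : (forall k x, (0 < k)%R -> cyc S k x -> bnd S k x) -> quasi_iso res_map.
Proof.
move=> S0; apply/quasi_isoP => -[[|k]|k]; split=> [y yP|x xP].
- exists (fbase R (mkcyc yP)); split; first by [].
  by rewrite [res_map _ _]flift_base subrr; apply: bnd0.
- move=> [b bE]; have [q [qx _]] := @next_exact 0 x b erefl bE.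
  by exists q; rewrite -qx; apply/esym; apply: (@res_diff_in 0).
- exists 0; rewrite linear0 sub0r; split; first exact: cyc0.
  by apply/bndN/S0.
- by move=> _; rewrite (@res_pos _ x) //; apply: bnd0.
- have [x [dx fx]] : exists x, res_step k x = 0 /\ res_aug (Negz k) x = y.
    have y0 : cdiff S (Negz k) (level k) y = 0 by rewrite -level_succ.
    case: k y yP y0 => [|k] y yP y0.
      by apply: (@next_exact 0 0 y); rewrite ?linear0.
    by apply: (@next_exact k.+1 0 y); rewrite ?linear0.
  exists x; split; first by rewrite /cyc /= level_succ res_diff_in.
  by rewrite [res_map _ _]fx subrr; apply: bnd0.
have x0 : res_step k x = 0 by rewrite -res_diff_in -level_succ.
have E : Negz k - 1 = Negz k.+1 by lia.
move=> Bx; have [b bE] : exists b, res_aug (Negz k) x = cdiff S (Negz k.+1) (Negz k) b.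
  by rewrite -E.
have [q [qx _]] := res_exact x0 bE.
suff : exists q, x = cdiff resolution (Negz k.+1) (Negz k) q by rewrite -E.
exists q; rewrite -qx; apply/esym; exact: (@res_diff_in k.+1).
Qed.

End Resolution.

(** * Finite supports from compactness *)

Section CompactFinite.
Variables (R : pzRingType) (S : complex R).
Hypotheses (S_compact : compact S)
  (S_pos : forall k x, (0 < k)%R -> cyc S k x -> bnd S k x).

(** By compactness the fraction psi w^-1 comes from a finite family. After refining the denominator
    by u, one homotopy s makes all components outside the finite set B null-homotopic at once. *)
Lemma compact_finite W (w : cmap W S) (J : choiceType) (X : J -> complex R)
    (psi : cmap W (csum X)) : quasi_iso w ->
  exists (W' : complex R) (u : cmap W' W) (B : set J)
    (s : forall i j, {linear W' i -> csum X j}),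
  [/\ quasi_iso (cmap_comp w u), finite_set B &
    forall n x j, ~ B j -> val (psi n (u n x)) j =
      val (cdiff (csum X) (n - 1) n (s n (n - 1) x) + s (n + 1) n (cdiff W' n (n + 1) x)) j].
Proof.
move=> qw; have [h _] := S_compact X; have [phi] := h (Roof qw psi).
move=> [W1 [s1 [q1 [f [g [Bfin gf _ [W' [u [v [qu _ [s sE]]]]]]]]]]].
exists W', u, [set j | ~ (forall n x, f j n x = 0)]%classic, s; split=> // n x j nBj.
rewrite -sE /=; have fj0 : forall n x, f j n x = 0 by apply: contrapT.
change (val (psi n (u n x)) j = val (psi n (u n x)) j - val (g n (v n x)) j).
by rewrite gf fj0 subr0.
Qed.

Lemma point_cmap (W X : complex R) n0 (f0 : {linear W n0 -> X n0}) :
  (forall i j x, cdiff X i j x = 0) -> (forall i x, f0 (cdiff W i n0 x) = 0) ->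
  exists f : cmap W X, f n0 = f0.
Proof.
move=> Xd f0d; pose t := dfwith (fun n => \0 : {linear W n -> X n}) f0.
have tn0 : t n0 = f0 by apply: dfwith_in.
have tP i j x : t j (cdiff W i j x) = cdiff X i j (t i x).
  rewrite Xd; have [<-|nj] := eqVneq n0 j; first by rewrite tn0.
  by rewrite /t dfwith_out.
by exists (Cmap tP).
Qed.

Local Notation F := (resolution S).
Local Notation eta := (res_map S).

(** The fraction phi w^-1 followed by [eta] induces the identity on H^0(S), while phi involves
    finitely many basis vectors in degree i. The case i = 0 bounds the generators of H^0(S). *)
Definition finite_at (i : int) : Prop :=
  exists (W : complex R) (w : cmap W S) (phi : cmap W F),
  [/\ quasi_iso w, forall z, cyc W 0 z -> bnd S 0 (w 0 z - eta 0 (phi 0 z)) &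
    exists B : set (res_basis S i), finite_set B /\
      forall x a, ~ B a -> val (phi i x) a = 0].

Lemma sub_htpy_aug (W W' : complex R) (w : cmap W S) (phi : cmap W F) (u : cmap W' W)
    (s : forall i j, {linear W' i -> F j}) :
  (forall z, cyc W 0 z -> bnd S 0 (w 0 z - eta 0 (phi 0 z))) ->
  forall z, cyc W' 0 z ->
    bnd S 0 (cmap_comp w u 0 z - eta 0 (sub_htpy (cmap_comp phi u) s 0 z)).
Proof.
move=> wphi z zP; rewrite sub_htpyE (zP : cdiff W' 0 (0 + 1) z = 0) linear0 addr0.
rewrite linearB opprB addrCA addrC; apply: bndD.
  by apply: (wphi (u 0 z)); apply: cyc_map.
exists (eta (0 - 1) (s 0 (0 - 1) z)); exact: (cmapP eta).
Qed.

(** A vector of degree k survives in the truncation to degrees at most -n only if n is at most -k,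
    so the projections form a map into the direct sum. Some component n is null-homotopic; its
    homotopy, included into the resolution and subtracted, makes the map zero in degree -n. *)
Lemma finite_at_low : exists n : nat, finite_at (- n%:Z).
Proof.
pose X (n : nat) := brutal (fun k : int => (k <= - n%:Z)%R) F.
have fin k (x : F k) : finite_set [set n | brutal_cut (fun k : int => (k <= - n%:Z)%R) F k x <> 0]%classic.
  apply: (@sub_finite_set _ _ `I_(`|k|.+1)%N); last exact: finite_II.
  move=> n /= nz; apply: contrapT => nk; apply: nz; apply: val_inj.
  by change ((if (k <= - n%:Z)%R then x else 0) = 0); rewrite ifF //; lia.
have psi_lin k : linear (fun x : F k => mkdsum (M := fun n => X n k) (fin k x)).
  by move=> a x y; apply: dsumP => n; apply: linearP.
have psiP i j x : mklin (psi_lin j) (cdiff F i j x) = cdiff (csum X) i j (mklin (psi_lin i) x).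
  apply: dsumP => n; apply: val_inj.
  change ((if (j <= - n%:Z)%R then cdiff F i j x else 0) =
    if (j <= - n%:Z)%R then cdiff F i j (if (i <= - n%:Z)%R then x else 0) else 0).
  case: ifP => // jn; have [ji|ij] := eqVneq j (i + 1); last by rewrite !cdiff_shape.
  by rewrite ifT //; lia.
have qeta := res_map_qis S_pos.
have [W [u [B [s [qu Bfin sE]]]]] := compact_finite
  (@Cmap R F (csum X) (fun k => mklin (psi_lin k)) psiP) qeta.
have [n nB] : exists n, ~ B n.
  apply: contrapT => /forallNP allB; apply: infinite_nat.
  by apply: sub_finite_set Bfin => n _; apply: contrapT; apply: allB.
pose s' i j : {linear W i -> F j} :=
  subinj (brutal_sub (fun k : int => (k <= - n%:Z)%R) F j) \o (dsum_proj (fun n => X n j) n \o s i j).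
exists n, W, (cmap_comp eta u), (sub_htpy (cmap_comp (cmap_id F) u) s'); split=> //.
  apply: sub_htpy_aug => z _; rewrite subrr; exact: bnd0.
exists set0; split=> // x a _.
have -> : sub_htpy (cmap_comp (cmap_id F) u) s' (- n%:Z) x = 0; last by [].
rewrite sub_htpyE; apply/eqP; rewrite subr_eq0; apply/eqP.
have := congr1 val (sE (- n%:Z) x n nB).
change ((if (- n%:Z <= - n%:Z)%R then u _ x else 0) =
   (if (- n%:Z <= - n%:Z)%R then cdiff F (- n%:Z - 1) (- n%:Z) (s' _ _ x) else 0)
   + s' _ _ (cdiff W (- n%:Z) (- n%:Z + 1) x) -> u _ x =
   cdiff F (- n%:Z - 1) (- n%:Z) (s' _ _ x) + s' _ _ (cdiff W (- n%:Z) (- n%:Z + 1) x)).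
by rewrite ifT ?ifT //; lia.
Qed.

Lemma free_support_zero (A : choiceType) (M : lmodType R) (g : {linear free R A -> M})
    (B : set A) (v : free R A) :
  (forall a, ~ B a -> val v a = 0) -> (forall a, B a -> g (fbase R a) = 0) -> g v = 0.
Proof.
move=> vB gB; have [r [ur rE]] := dsum_supp v.
rewrite (dsum_decomp ur rE) linear_sum big1 // => a _.
have [Ba|nBa] := pselect (B a); last by rewrite vB // linear0 linear0.
by rewrite fbaseZ linearZ /= gB // scaler0.
Qed.

(** Since phi d = d phi, the boundaries of W in degree i + 1 have image supported in the finite set
    [B']. The coordinates outside [B'] therefore kill boundaries and form a chain map to a sum of
    stalks R. By compactness all but finitely many of them factor through d, and this part is
    subtracted as a homotopy. *)
Lemma finite_at_succ i : finite_at i -> finite_at (i + 1).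
Proof.
move=> [W [w [phi [qw wphi [B [Bfin phiB]]]]]].
pose A := res_basis S (i + 1).
pose B' : set A := (\bigcup_(b in B) [set a | val (cdiff F i (i + 1) (fbase R b)) a <> 0])%classic.
have B'fin : finite_set B' by apply: bigcup_finite => // b _; apply: dsum_fin.
have phi_d x a : ~ B' a -> val (phi (i + 1) (cdiff W i (i + 1) x)) a = 0.
  move=> nB'; rewrite cmapP.
  apply: (@free_support_zero _ _ (dsum_proj _ a \o cdiff F i (i + 1)) B) => [b|b Bb].
    exact: phiB.
  by apply: contrapT => nz; apply: nB'; exists b.
pose X (a : A) := stalk (R^o : lmodType R) (i + 1).
pose cut x a : R^o := if `[< B' a >] then 0 else val (phi (i + 1) x) a.
have fin (x : W (i + 1)) : finite_set [set a | stalk_in (R^o : lmodType R) (i + 1) (i + 1) (cut x a) <> 0]%classic.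
  apply: sub_finite_set (dsum_fin (phi (i + 1) x)) => a nz phia; apply: nz.
  suff -> : cut x a = 0 by rewrite linear0.
  by rewrite /cut; case: asboolP => // _; apply: phia.
have psi_lin : linear (fun x : W (i + 1) => mkdsum (M := fun a => X a (i + 1)) (fin x)).
  move=> c x y; apply: dsumP => a; rewrite -[RHS]linearP; congr (stalk_in _ _ _ _).
  by rewrite /cut; case: asboolP => _; rewrite ?scaler0 ?addr0 // linearP.
have Xd p q x : cdiff (csum X) p q x = 0.
  by apply: dsumP => a; apply: stalk_diff.
have psi_d p x : mklin psi_lin (cdiff W p (i + 1) x) = 0.
  have [pi|pi] := eqVneq (i + 1) (p + 1); last by rewrite cdiff_shape // linear0.
  have Ep := addIr _ pi; subst p; apply: dsumP => a.
  change (stalk_in (R^o : lmodType R) (i + 1) (i + 1) (cut (cdiff W i (i + 1) x) a) = 0).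
  by rewrite /cut; case: asboolP => [_|/phi_d ->]; rewrite linear0.
have [psi psiE] := point_cmap Xd psi_d.
have [W' [u [C [s [qu Cfin sE]]]]] := compact_finite psi qw.
have ufin j (v : csum X j) : finite_set [set a | stalk_val _ _ j (val v a) <> 0]%classic.
  apply: sub_finite_set (dsum_fin v) => a nz va; apply: nz.
  change (stalk_val (R^o : lmodType R) (i + 1) j (val v a) = 0).
  by rewrite va linear0.
have un_lin j : linear (fun v : csum X j => mkdsum (M := fun a : A => (R^o : lmodType R)) (ufin j v)).
  by move=> c x y; apply: dsumP => a; apply: linearP.
pose un j : {linear csum X j -> F (i + 1)} := mklin (un_lin j).
(* Only the maps into degree i + 1 are kept, so in that degree the correction is the single term
   s'd. *)
pose s' p q : {linear W' p -> F q} :=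
  dfwith (fun q => \0 : {linear W' p -> F q}) (un (i + 1) \o s p (i + 1)) q.
have s'in p x : s' p (i + 1) x = un (i + 1) (s p (i + 1) x) by rewrite /s' dfwith_in.
have s'out p q x : q != i + 1 -> s' p q x = 0.
  by move=> qi; rewrite /s' dfwith_out // eq_sym.
exists W', (cmap_comp w u), (sub_htpy (cmap_comp phi u) s'); split=> //.
  exact: sub_htpy_aug.
exists (B' `|` C)%classic; split; first by rewrite finite_setU.
move=> x a /not_orP[nB' nC].
rewrite sub_htpyE s'out ?linear0 ?add0r; last by lia.
rewrite s'in.
change (val (phi (i + 1) (u (i + 1) x)) a -
  stalk_val _ (i + 1) (i + 1) (val (s (i + 1 + 1) (i + 1) (cdiff W' (i + 1) (i + 1 + 1) x)) a) = 0).
have := sE (i + 1) x a nC; rewrite Xd add0r psiE => <-.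
rewrite [X in _ - stalk_val _ _ _ X](_ : _ = stalk_in (R^o : lmodType R) (i + 1) (i + 1) (cut (u (i + 1) x) a)) //.
by rewrite stalk_inE eqxx /cut; case: asboolP => // _; rewrite subrr.
Qed.

(* phi, an endomorphism of the resolution in the derived category representing
   the identity, is made to have finite support one degree after the other.  It
   can be made zero in some low degree because, by compactness, the map from S
   to the sum of all brutal truncations of its resolution has almost all its
   components zero. *)
Lemma compact_fg_cyc : fg_cyc S 0.
Proof.
have fin0 : finite_at 0.
  have [n] := finite_at_low; elim: n => [//|n IHn] fn; apply: IHn.
  have -> : - n%:Z = - n.+1%:Z + 1 by lia.
  exact: finite_at_succ.
have [W [w [phi [qw wphi [B [Bfin phiB]]]]]] := fin0.
have [r rE] := (finite_seqP _).1 Bfin.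
pose g (k : 'I_(size (undup r))) := fbase R (tnth (in_tuple (undup r)) k).
exists (size (undup r)), (fun k => eta 0 (g k)); split=> [k|y yP]; first exact: res_aug_cyc.
have [ws _] := (quasi_isoP w).1 qw 0; have [z [zP Bz]] := ws y yP.
pose c k : R := val (phi 0 z) (tnth (in_tuple (undup r)) k).
exists c; have supp a : val (phi 0 z) a <> 0 -> a \in undup r.
  move=> nz; rewrite mem_undup; suff : B a by rewrite rE.
  by apply: contrapT => nB; apply: nz; apply: phiB.
have phiE : phi 0 z = \sum_k c k *: g k.
  rewrite {1}(dsum_decomp (undup_uniq r) supp) big_tnth; apply: eq_bigr => k _.
  exact: fbaseZ.
have -> : \sum_k c k *: eta 0 (g k) = eta 0 (phi 0 z).
  by rewrite [in RHS]phiE linear_sum; apply: eq_bigr => k _; rewrite linearZ.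
rewrite -[y](subKr (w 0 z)) addrAC; apply: bndB => //; exact: wphi.
Qed.

End CompactFinite.

(** * From a compactly generated t-structure to I = ReR *)

Section TCGToFull.
Variables (R : pzRingType) (I : submodClosed R^o).
Hypothesis I_two_sided : two_sided I.
Variable e : R.
Hypotheses (Ie : (e : R^o) \in I) (ee : e * e = e).
Hypothesis e_jac : forall x : R, (x : R^o) \in I -> jac (x * (1 - e)).

(** If eY = 0, the stalk of Y in degree 0 is orthogonal to all generators and their shifts, hence
    lies in U^perp, and its H^0, which is Y, is killed by I. *)
Lemma full_of_tCG : tCG (C_class I) (T_class I) -> full_idempotent I e.
Proof.
move=> [_ [J [S [cS SP]]]]; apply: full_idempotent_test => // Y eY.
have aisle j : (forall k x, (0 < k)%R -> cyc (S j) k x -> bnd (S j) k x) /\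
  (forall x, cyc (S j) 0 x -> exists t, ideal_smul I (cyc (S j) 0) t /\ bnd (S j) 0 (x - t)).
  apply: aisle_cohomology.
  exact: ((SP _).1 (perp_trunc_orthogonal I (shift (S j) 0)) j 0%N).
have [_ TY] : (hrs_t_structure (C_class I) (T_class I)).2 (stalk Y 0).
  apply/SP => j k; have [S0 SC] := aisle j.
  exact: (derived_hom_killed I_two_sided e_jac eY S0 SC (compact_fg_cyc (cS j) S0)).
apply/T_classP => a y Ia.
have [|b bE] := (cohomology_TP _ _ _).1 TY a (stalk_in Y 0 0 y) Ia; first exact: stalk_diff.
have := congr1 (stalk_val Y 0 0) bE.
by rewrite stalk_diff linearZ stalk_inE linear0.
Qed.

End TCGToFull.

(** * The equivalence of the five conditions *)

Theorem corollary23 (R : pzRingType) (I : submodClosed R^o)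
    (semiperfectR : semiperfect R)
    (I_two_sided : two_sided I)
    (I_idempotent : idempotent_ideal I) :
  [<-> (* (a) *)
       silting (quotmod I);
       (* (b) *)
       exists P : lmodType R, projective P /\ trace P = [set` I]%classic;
       (* (c) *)
       exists (X : choiceType) (M : X -> lmodType R),
         (forall i, [/\ finitely_generated (M i), projective (M i)
                      & C_class I (M i)]) /\
         (forall N, Gen (dsum M) N <-> C_class I N);
       (* (d) *)
       exists (X : choiceType) (M : X -> lmodType R),
         (forall i, finitely_generated (M i) /\
                    C_class I (M i)) /\
         (forall N, Gen (dsum M) N <-> C_class I N);
       (* (e) *)
       tCG (C_class I) (T_class I)].
Proof.
have [e [Ie ee e_jac]] := semiperfect_idempotent I semiperfectR.
tfae.
- move=> /(full_of_silting I_two_sided semiperfectR Ie ee e_jac) full_e.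
  exists (submod (Re e)); split; first exact: projective_Re full_e.
  exact: trace_Re.
- move=> [P [PP /(full_of_trace I_two_sided Ie ee e_jac PP) full_e]].
  exists unit, (fun=> submod (Re e)); split=> [_|N]; last exact: Gen_Re.
  by split; [exact: fg_Re full_e|exact: projective_Re full_e|exact: C_class_Re].
- by move=> [X [M [MP GM]]]; exists X, M; split=> // i; case: (MP i).
- move=> [X [M [MP GM]]]; apply: tCG_of_full => //.
  exact: (full_of_gen I_two_sided Ie ee e_jac I_idempotent MP GM).
move=> /(full_of_tCG I_two_sided Ie ee e_jac) full_e; exact: silting_of_full full_e.
Qed.
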